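(* Let $(X,d)$ be a Polish metric space, $1<p<\infty$, $E:\mathcal P_p(X)\to(-\infty,+\infty]$ proper and $G:\mathcal P_p(X)\to[0,+\infty]$ a weak upper gradient for $E$, satisfying (A1), (A3) and either (A2) or (A2'). Assume that for every $\rho_0\in Z_{E,p}$ there exists a $p$-curve of maximal slope $\rho\in AC([0,\infty);\mathcal P_p(X))$ of $E$ with respect to $G$ with $\rho(0)=\rho_0$. Then for any such curve $\rho$, $$\lim_{t\to\infty}d_\sigma(\rho(t),\mathcal E)=\lim_{t\to\infty}\inf_{\mu\in\mathcal E}d_\sigma(\rho(t),\mu)=0.$$ Furthermore, if (A2') is satisfied with a set $\mathcal Y$ that is closed in the $\sigma$-topology on $\mathcal P_p(X)$, then $\lim_{t\to\infty}d_\sigma(\rho(t),\mathcal E\cap\mathcal Y)=0$.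
   Context: $\mathcal P(X)$: Borel probability measures on $X$ with the narrow topology, metrised by the Lévy–Prokhorov metric $d_{LP}$. $\mathcal P_p(X)$: measures with finite $p$-th moment, with the $p$-Wasserstein distance $W_p$. The $\sigma$-topology on $\mathcal P_p(X)$ is the narrow topology restricted to $\mathcal P_p(X)$, metrised by $d_\sigma$, the restriction of $d_{LP}$. $q=p/(p-1)$. $\rho\in AC([0,\infty);\mathcal P_p(X))$ means: for each $T>0$ there is $m\in L^1([0,T])$ with $W_p(\rho(t),\rho(s))\le\int_s^tm$ for $0\le s<t\le T$; metric derivative $|\rho'|(t)=\lim_{s\to t}W_p(\rho(t),\rho(s))/|t-s|$ (exists a.e.). $G$ is a weak upper gradient for $E$ if for every absolutely continuous curve $\rho$ on $[0,T]$ with $(G\circ\rho)|\rho'|\in L^1([0,T])$, $E\circ\rho$ is a.e. equal to a function $\varphi$ of finite pointwise variation with $|\varphi'|\le G(\rho)|\rho'|$ a.e. A $p$-curve of maximal slope for $E$ w.r.t. $G$ is $\rho\in AC([0,\infty);\mathcal P_p(X))$ with $E\circ\rho$ a.e. equal to a non-increasing $\varphi$ satisfying $\varphi'(t)=-\frac1p|\rho'|^p(t)-\frac1qG^q(\rho(t))$ for a.e. $t$. $Z_{E,p}=\{\rho\in\mathcal P_p(X):E(\rho)<\infty\}$. A stationary state is $\mu\in\mathcal P_p(X)$ with $E(\mu)<\infty$ such that the constant curve $\equiv\mu$ is a $p$-curve of maximal slope; $\mathcal E$ is the set of stationary states. $d_\sigma(\mu,A)=\inf_{\nu\in A}d_\sigma(\mu,\nu)$.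 (A1) $E$ proper, bounded below, l.s.c. w.r.t. the $\sigma$-topology. (A2) For every $C\in\mathbb R$, $\{\mu\in\mathcal P_p(X):E(\mu)\le C\}$ is relatively compact in the $\sigma$-topology. (A2') There is $\mathcal Y\subset\mathcal P_p(X)$ containing $\rho(t)$ for all $t\ge0$ such that $\{\mu\in\mathcal P_p(X)\cap\mathcal Y:E(\mu)\le C\}$ is relatively compact in the $\sigma$-topology for every $C$. (A3) $G$ l.s.c. w.r.t. the $\sigma$-topology. *)

(* Defs.v *)
From HB Require Import structures.
From mathcomp Require Import all_boot all_order all_algebra.
From mathcomp Require Import all_classical all_reals all_analysis.
Set Implicit Arguments. Unset Strict Implicit. Unset Printing Implicit Defensive.
Import Order.TTheory GRing.Theory Num.Theory numFieldNormedType.Exports.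
Local Open Scope classical_set_scope.
Local Open Scope ring_scope.

Section Defs.
Context {R : realType} {dX : measure_display} {X : measurableType dX}.
Variable dist : X -> X -> R.

Definition is_metric : Prop :=
  [/\ (forall x y, 0 <= dist x y), (forall x y, dist x y = 0 <-> x = y),
      (forall x y, dist x y = dist y x) &
      (forall x y z, dist x z <= dist x y + dist y z)].

Definition metric_open (A : set X) : Prop :=
  forall x, A x -> exists2 e : R, 0 < e & [set y | dist x y < e] `<=` A.

Definition metric_complete : Prop :=
  forall u : nat -> X,
    (forall e : R, 0 < e -> exists N, forall m n, (N <= m)%N -> (N <= n)%N ->
        dist (u m) (u n) < e) ->
    exists x, forall e : R, 0 < e -> exists N, forall n, (N <= n)%N ->
        dist (u n) x < e.

Definition metric_separable : Prop :=
  exists D : set X, countable D /\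
    forall x (e : R), 0 < e -> exists2 y, D y & dist x y < e.

Definition polish_borel : Prop :=
  [/\ is_metric, metric_complete, metric_separable &
      @measurable _ X = <<s metric_open >>].

Definition Pp (p : R) : set (probability X R) :=
  [set mu | exists x0 : X,
     (\int[mu]_x ((dist x0 x) `^ p)%:E < +oo)%E].

Definition coupling (mu nu : probability X R) : set (probability (X * X)%type R) :=
  [set pi | forall A : set X, measurable A ->
     pi (A `*` setT) = mu A /\ pi (setT `*` A) = nu A].

Definition Wp (p : R) (mu nu : probability X R) : R :=
  (fine (ereal_inf [set (\int[pi]_z ((dist z.1 z.2) `^ p)%:E)%E
                   | pi in coupling mu nu])) `^ p^-1.

Definition enlarge (A : set X) (e : R) : set X :=
  [set x | exists2 a, A a & dist x a < e].

Definition dLP (mu nu : probability X R) : R :=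
  inf [set e : R | 0 < e /\ forall A : set X, measurable A ->
         (mu A <= nu (enlarge A e) + e%:E)%E /\
         (nu A <= mu (enlarge A e) + e%:E)%E].

(** The sigma-topology on P_p(X): narrow topology restricted to P_p(X),
    metrised by d_sigma = dLP restricted to P_p(X). *)
Definition dLP_cvg (u : nat -> probability X R) (mu : probability X R) : Prop :=
  (fun n => dLP (u n) mu) @ \oo --> (0 : R).

Definition sigma_lsc (p : R) (F : probability X R -> \bar R) : Prop :=
  forall mu, Pp p mu -> forall c : R, (c%:E < F mu)%E ->
    exists2 d : R, 0 < d & forall nu, Pp p nu -> dLP nu mu < d -> (c%:E < F nu)%E.

Definition sigma_relcompact (p : R) (A : set (probability X R)) : Prop :=
  forall u : nat -> probability X R, (forall n, A (u n)) ->
    exists phi : nat -> nat, {homo phi : m n / (m < n)%N} /\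
      exists2 mu, Pp p mu & dLP_cvg (u \o phi) mu.

Definition sigma_closed (p : R) (Y : set (probability X R)) : Prop :=
  Y `<=` Pp p /\
  forall (u : nat -> probability X R) mu, (forall n, Y (u n)) -> Pp p mu ->
    dLP_cvg u mu -> Y mu.

Definition AC_on (p T : R) (rho : R -> probability X R) : Prop :=
  (forall t, 0 <= t <= T -> Pp p (rho t)) /\
  exists m : R -> R, lebesgue_measure.-integrable `[0, T] (EFin \o m) /\
    forall s t, 0 <= s -> s < t -> t <= T ->
      ((Wp p (rho t) (rho s))%:E <= \int[lebesgue_measure]_(x in `[s, t]) (m x)%:E)%E.

Definition AC_infty (p : R) (rho : R -> probability X R) : Prop :=
  forall T : R, 0 < T -> AC_on p T rho.

Definition mder (p : R) (rho : R -> probability X R) (t : R) : R :=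
  lim ((fun s => Wp p (rho t) (rho s) / `|t - s|) @ t^').

Definition conj_exp (p : R) : R := p / (p - 1).

Definition weak_upper_gradient (p : R) (E G : probability X R -> \bar R) : Prop :=
  forall (T : R) (rho : R -> probability X R), 0 < T -> AC_on p T rho ->
    lebesgue_measure.-integrable `[0, T] (fun t => (G (rho t) * (mder p rho t)%:E)%E) ->
    exists phi : R -> R,
      [/\ {ae lebesgue_measure, forall t, [set` `[0, T]] t -> E (rho t) = (phi t)%:E},
          bounded_variation 0 T phi &
          {ae lebesgue_measure, forall t, [set` `[0, T]] t ->
              derivable phi t 1 /\
              ((`|derive1 phi t|)%:E <= G (rho t) * (mder p rho t)%:E)%E}].

Definition max_slope_curve (p : R) (E G : probability X R -> \bar R)
    (rho : R -> probability X R) : Prop :=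
  AC_infty p rho /\
  exists phi : R -> R,
    [/\ {ae lebesgue_measure, forall t, 0 <= t -> E (rho t) = (phi t)%:E},
        (forall s t, 0 <= s -> s <= t -> phi t <= phi s) &
        {ae lebesgue_measure, forall t, 0 <= t ->
           derivable phi t 1 /\
           ((derive1 phi t)%:E = - (p^-1 * (mder p rho t) `^ p)%:E
                              - (conj_exp p)^-1%:E * (G (rho t) `^ (conj_exp p)))%E}].

Definition ZE (p : R) (E : probability X R -> \bar R) : set (probability X R) :=
  [set mu | Pp p mu /\ (E mu < +oo)%E].

Definition stationary (p : R) (E G : probability X R -> \bar R) : set (probability X R) :=
  [set mu | [/\ Pp p mu, (E mu < +oo)%E & max_slope_curve p E G (fun _ => mu)]].

Definition dsigma_set (mu : probability X R) (A : set (probability X R)) : \bar R :=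
  ereal_inf [set (dLP mu nu)%:E | nu in A].

Definition E_proper (p : R) (E : probability X R -> \bar R) : Prop :=
  (exists mu, Pp p mu /\ (E mu < +oo)%E) /\ (forall mu, Pp p mu -> (-oo < E mu)%E).

Definition A1 (p : R) (E : probability X R -> \bar R) : Prop :=
  [/\ E_proper p E, (exists c : R, forall mu, Pp p mu -> (c%:E <= E mu)%E) &
      sigma_lsc p E].

Definition A2 (p : R) (E : probability X R -> \bar R) : Prop :=
  forall C : R, sigma_relcompact p [set mu | Pp p mu /\ (E mu <= C%:E)%E].

Definition A2' (p : R) (E : probability X R -> \bar R)
    (rho : R -> probability X R) (Y : set (probability X R)) : Prop :=
  [/\ Y `<=` Pp p, (forall t, 0 <= t -> Y (rho t)) &
      forall C : R, sigma_relcompact p [set mu | [/\ Pp p mu, Y mu & (E mu <= C%:E)%E]]].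

Definition A3 (p : R) (G : probability X R -> \bar R) : Prop := sigma_lsc p G.

End Defs.

(* Main.v *)
Require Import Defs.
From HB Require Import structures.
From mathcomp Require Import all_boot all_order all_algebra.
From mathcomp Require Import all_classical all_reals all_analysis.
From mathcomp Require Import measurable_realfun.
From mathcomp Require Import ring lra.
Set Implicit Arguments. Unset Strict Implicit. Unset Printing Implicit Defensive.
Import Order.TTheory GRing.Theory Num.Theory numFieldNormedType.Exports.
Local Open Scope classical_set_scope.
Local Open Scope ring_scope.

(** Since phi is non-increasing and bounded below, the dissipation
    |rho'|^p / p + G(rho)^q / q = -phi' has a small integral over [t, t + 1] when
    t is large. Hence some s in that window has G(rho(s)) small,
    and rho(s) is W_p-close, so d_sigma-close, to rho(t). Every sigma-limit mu of
    rho(t_n), t_n -> oo, is thus also the limit of states whose slope tends to 0,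
    so G(mu) = 0 by lower semicontinuity and mu is stationary; compactness of the
    sublevels of E concludes.
    Comparing W_p(rho(t), rho(s)) with the integral of |rho'| rests on the a.e.
    existence of the metric derivative, hence on the triangle inequality for W_p. *)

(** * The Wasserstein and Prokhorov distances *)

(** The infima in [Wp] and [dLP] are handled through almost optimal witnesses and strict
    inequalities. An inexact gluing of transport plans then suffices: two plans are joined along a
    countable partition of [X] into cells of diameter less than [e], at the price of an extra [e] in
    the triangle inequality, which afterwards tends to 0. The energy identity enters as an
    inequality. A monotone [phi] may have jumps or a singular part, so the integral of -phi' is only
    bounded by the drop of [phi], and it is this drop that tends to 0. The equality of [E] along the
    curve with [phi] holds almost everywhere, whereas compactness is applied to the curve at
    arbitrary times. Lower semicontinuity of [E] and continuity of the curve close this gap. *)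

Section gluing.
Context {R : realType}.

Lemma pushforward_probability d d' (T : measurableType d) (U : measurableType d')
    (P : probability T R) (f : T -> U) : measurable_fun setT f ->
  exists2 Q : probability U R, (forall A, Q A = P (f @^-1` A)) &
    forall g : U -> R, measurable_fun setT g -> (forall y, 0 <= g y) ->
      (\int[Q]_y (g y)%:E = \int[P]_x (g (f x))%:E)%E.
Proof.
move=> mf; pose fM : {mfun T >-> U} := HB.pack f (isMeasurableFun.Build _ _ _ _ _ mf).
exists (distribution P fM) => [//|g mg g0].
rewrite (eq_measure_integral (pushforward P fM))//.
rewrite ge0_integral_pushforward//; first exact/measurable_EFinP.
by move=> y _; rewrite lee_fin.
Qed.

Section probability_of_measure.
Context d (T : measurableType d) (mu : {measure set T -> \bar R}).

(** The proof of total mass 1 is an argument, so that the probability structure can be inferred from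
    the term itself. *)
Definition probability_of_measure of mu setT = 1%E : set T -> \bar R := mu.

Hypothesis mu1 : mu setT = 1%E.

HB.instance Definition _ := Measure.on (probability_of_measure mu1).
HB.instance Definition _ :=
  Measure_isProbability.Build _ _ _ (probability_of_measure mu1) mu1.
End probability_of_measure.

(** * Gluing two transport plans along a partition of the middle space *)

Section glue.
Context d1 d2 d3 (X : measurableType d1) (Y : measurableType d2) (Z : measurableType d3).
Variables (P : probability (X * Y)%type R) (Q : probability (Y * Z)%type R).
Variable B : nat -> set Y.
Hypotheses (mB : forall i, measurable (B i)) (tB : trivIset setT B)
  (cB : \bigcup_i B i = setT).
Hypothesis PQ : forall A, measurable A -> P (setT `*` A) = Q (A `*` setT).

Let rect i : set ((X * Y) * (Y * Z)) := (setT `*` B i) `*` (B i `*` setT).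
Let mrect i : measurable (rect i).
Proof. by apply: measurableX; apply: measurableX. Qed.
Let weight_ge0 i : 0 <= (fine (Q (B i `*` setT)))^-1.
Proof. by rewrite invr_ge0 fine_ge0. Qed.
(* Conditionally on the common cell [B i] of the two middle coordinates, the two
   plans are independent. Null cells get weight 0^-1 = 0. *)
Let glued := mseries (fun i =>
  mscale (NngNum (weight_ge0 i)) (mrestr (P \x Q)%E (mrect i))) 0.

Let gluedX S U : measurable S -> measurable U ->
  glued (S `*` U) = (\sum_(0 <= i <oo) ((fine (Q (B i `*` setT)))^-1%:E *
    (P (S `&` (setT `*` B i)) * Q (U `&` (B i `*` setT)))))%E.
Proof.
move=> mS mU; rewrite /glued /mseries; apply: eq_eseriesr => i _.
rewrite /mscale/=; congr (_ * _)%E.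
rewrite -product_measure1E.
- congr (product_measure1 _ _ _); apply/seteqP; split => w; rewrite /rect/=; tauto.
- by apply: measurableI => //; exact: measurableX.
- by apply: measurableI => //; exact: measurableX.
Qed.

(** On a null cell the upper bound forces [x = 0], so the default weight does no harm; on any other
    cell the two factors cancel. *)
Let weightK i (x : \bar R) : (0 <= x <= Q (B i `*` setT))%E ->
  ((fine (Q (B i `*` setT)))^-1%:E * (x * Q (B i `*` setT)) = x)%E.
Proof.
move=> /andP[x0 xQ]; have [q0|q0] := eqVneq (Q (B i `*` setT)) 0%E.
  rewrite q0 !mule0; apply/esym/eqP; rewrite eq_le x0 andbT.
  by rewrite -q0.
have qf : Q (B i `*` setT) \is a fin_num.
  by apply: fin_num_measure; exact: measurableX.
have xf : x \is a fin_num.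
  by rewrite ge0_fin_numE// (le_lt_trans xQ)// ltey_eq qf.
rewrite -(fineK xf) -[in X in (_ * X)%E](fineK qf) -!EFinM.
congr (_%:E); rewrite mulrC -mulrA mulfV ?mulr1//.
by rewrite fine_eq0.
Qed.

(** In each cell the mass under [Q] cancels the weight, and what remains is the mass of [S] over
    that cell; the cells exhaust the middle coordinate. *)
Let glued1 S : measurable S -> glued (S `*` setT) = P S.
Proof.
move=> mS; rewrite gluedX//.
rewrite (eq_eseriesr (g := fun i => P (S `&` (setT `*` B i)))); last first.
  move=> i _; rewrite setTI weightK// measure_ge0/= -PQ//.
  by apply: le_measure; rewrite ?inE//; [apply: measurableI => //|]; apply: measurableX.
rewrite (eq_eseriesl (Q := fun i => i \in [set: nat])); last by move=> i; rewrite in_setT.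
rewrite -(measure_bigcup P setT (fun i => S `&` (setT `*` B i))).
- congr (P _); rewrite -setI_bigcupr; apply/seteqP; split => [z []//|[x y] Sxy].
  split => //; have : (\bigcup_i B i) y by rewrite cB.
  by move=> [i _ Biy]; exists i.
- by move=> i _; apply: measurableI => //; exact: measurableX.
- apply/trivIsetP => i j _ _ ij; apply/seteqP; split => // -[x y] /= [[_ [_ Bi]] [_ [_ Bj]]].
  by move/trivIsetP : tB => /(_ i j Logic.I Logic.I ij) BB; have : (B i `&` B j) y by []; rewrite BB.
Qed.

Let glued2 S : measurable S -> glued (setT `*` S) = Q S.
Proof.
move=> mS; rewrite gluedX//.
rewrite (eq_eseriesr (g := fun i => Q (S `&` (B i `*` setT)))); last first.
  move=> i _; rewrite setTI PQ// [X in (_ * X)%E]muleC weightK// measure_ge0/=.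
  by apply: le_measure; rewrite ?inE//; [apply: measurableI => //|]; apply: measurableX.
rewrite (eq_eseriesl (Q := fun i => i \in [set: nat])); last by move=> i; rewrite in_setT.
rewrite -(measure_bigcup Q setT (fun i => S `&` (B i `*` setT))).
- congr (Q _); rewrite -setI_bigcupr; apply/seteqP; split => [z []//|[x y] Sxy].
  split => //; have : (\bigcup_i B i) x by rewrite cB.
  by move=> [i _ Biy]; exists i.
- by move=> i _; apply: measurableI => //; exact: measurableX.
- apply/trivIsetP => i j _ _ ij; apply/seteqP; split => // -[x y] /= [[_ [Bi _]] [_ [Bj _]]].
  by move/trivIsetP : tB => /(_ i j Logic.I Logic.I ij) BB; have : (B i `&` B j) x by []; rewrite BB.
Qed.

(* Replaces the disintegration in the gluing lemma: the two copies of the middle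
   coordinate share a cell instead of being equal. *)
Lemma glue_along_partition : exists G : probability ((X * Y) * (Y * Z))%type R,
  [/\ forall S, measurable S -> G (S `*` setT) = P S,
      forall S, measurable S -> G (setT `*` S) = Q S &
      forall N, measurable N -> (forall w i, N w -> B i w.1.2 -> B i w.2.1 -> False) ->
        G N = 0%E].
Proof.
have gT : glued setT = 1%E.
  by have := glued1 measurableT; rewrite setXTT probability_setT.
exists (probability_of_measure gT); split=> [S mS|S mS|N mN NB].
- exact: glued1.
- exact: glued2.
- rewrite /probability_of_measure/= /mseries eseries0// => i _ _.
  transitivity ((fine (Q (B i `*` setT)))^-1%:E * (P \x Q)%E set0)%E; last first.
    by rewrite measure0 mule0.
  congr (_ * _)%E; congr (product_measure1 _ _ _).
  apply/seteqP; split => // w [Nw [[_ B1] [B2 _]]].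
  by have := NB _ _ Nw B1 B2.
Qed.
End glue.
End gluing.

(** * Measurability of the distance and small partitions of a Polish space *)

Section Wasserstein.
Context {R : realType} {dX : measure_display} {X : measurableType dX}.
Variable dist : X -> X -> R.
Hypothesis pb : polish_borel dist.

Let dist_ge0 x y : 0 <= dist x y. Proof. by have [[]] := pb. Qed.
Let dist_eq0 x y : dist x y = 0 <-> x = y. Proof. by have [[]] := pb. Qed.
Let distC x y : dist x y = dist y x. Proof. by have [[]] := pb. Qed.
Let dist_tri x y z : dist x z <= dist x y + dist y z.
Proof. by have [[]] := pb. Qed.

Lemma metric_open_measurable A : metric_open dist A -> measurable A.
Proof. by move=> oA; have [_ _ _ ->] := pb; exact: sub_sigma_algebra. Qed.

(** A union of open balls is open, whatever [A] is. *)
Lemma measurable_enlarge A e : measurable (enlarge dist A e).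
Proof.
apply: metric_open_measurable => x [a Aa xa].
exists (e - dist x a); first by rewrite subr_gt0.
move=> y /= xy; exists a => //.
rewrite (le_lt_trans (dist_tri _ x _))// distC; lra.
Qed.

Lemma measurable_lt_fun d (T : measurableType d) (f : T -> R) :
  (forall r, measurable [set x | f x < r]) -> measurable_fun setT f.
Proof.
move=> H; apply: (measurability (@RGenCInfty.G R)) => [|/= _ [_] [r] -> <-].
  exact: RGenCInfty.measurableE.
rewrite setTI (_ : _ @^-1` _ = ~` [set x | f x < r]); first exact: measurableC.
by apply/seteqP; split=> x /=; rewrite in_itv/= andbT leNgt => /negP.
Qed.

Lemma measurable_dist1 x0 : measurable_fun setT (dist x0).
Proof.
apply: measurable_lt_fun => r.
rewrite (_ : [set x | _] = enlarge dist [set x0] r); first exact: measurable_enlarge.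
by apply/seteqP; split=> [x|x [_ ->]] /=; rewrite distC // => ?; exists x0.
Qed.

(** The countable dense set is enumerated through an injection into [nat]; numbers that code no
    point of it are sent to [x0]. *)
Lemma dense_seq (x0 : X) : exists D : nat -> X,
  forall x e, 0 < e -> exists n, dist x (D n) < e.
Proof.
have [_ _ [D [/countable_injP[f finj] dD]] _] := pb.
exists (fun n => xget x0 [set y | D y /\ f y = n]) => x e e0.
have [y Dy xy] := dD x e e0; exists (f y).
case: xgetP => [z _ [Dz fz]|/(_ y)]; last by case.
by rewrite (finj z y) ?inE.
Qed.

(** Measurability for the product sigma-algebra rests on separability: [dist x y < r] if and only if
    some dense point [D n] satisfies [dist (D n) x + dist (D n) y < r], a countable union of
    conditions on functions of one coordinate. *)
Lemma measurable_dist2 : measurable_fun setT (fun z : X * X => dist z.1 z.2).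
Proof.
have [->|/set0P[[x0 _] _]] := eqVneq [set: X * X] set0.
  by move=> _ A mA; rewrite set0I.
have [D dD] := dense_seq x0.
apply: measurable_lt_fun => r.
rewrite (_ : [set z | _] =
  \bigcup_n ([set z : X * X | dist (D n) z.1 + dist (D n) z.2 < r])).
  apply: bigcupT_measurable => n; rewrite -[X in measurable X]setTI.
  have mDn : measurable_fun setT (fun z : X * X => dist (D n) z.1 + dist (D n) z.2).
    apply: measurable_funD; apply: measurableT_comp => //; exact: measurable_dist1.
  rewrite (_ : [set z | _] = (fun z : X * X => dist (D n) z.1 + dist (D n) z.2) @^-1` `]-oo, r[).
    by apply: mDn => //; exact: measurable_itv.
  by apply/seteqP; split => z /=; rewrite in_itv.
apply/seteqP; split => [[x y] /= xyr|[x y] [n _] /=]; last first.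
  by apply: le_lt_trans; rewrite (distC (D n) x).
(* The distance from [x] to the dense point is counted twice, hence half of the slack. *)
have e0 : 0 < (r - dist x y) / 2 by rewrite divr_gt0// subr_gt0.
have [n xn] := dD x _ e0.
exists n => //=; have := dist_tri (D n) x y; rewrite (distC (D n) x).
move: xn; lra.
Qed.

Lemma small_partition (x0 : X) (e : R) : 0 < e -> exists B : nat -> set X,
  [/\ forall i, measurable (B i), trivIset setT B, \bigcup_i B i = setT &
      forall i x y, B i x -> B i y -> dist x y < e].
Proof.
move=> e0; have [D dD] := dense_seq x0.
pose F n := enlarge dist [set D n] (e / 2).
exists (seqDU F); split.
- move=> i; apply: measurableD; first exact: measurable_enlarge.
  by apply: bigsetU_measurable => j _; exact: measurable_enlarge.
- exact: trivIset_seqDU.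
- rewrite -seqDU_bigcup_eq; apply/seteqP; split => // x _.
  by have [n xn] := dD x _ (divr_gt0 e0 (ltr0n R 2)); exists n => //; exists (D n).
- move=> i x y [[_ ->] xn] _ [[_ ->] yn] _.
  rewrite (le_lt_trans (dist_tri _ (D i) _))// [ltRHS]splitr (distC (D i)).
  by rewrite ltrD.
Qed.

(** * Transport plans and the triangle inequality for the Wasserstein distance *)

Variable p : R.
Hypothesis p1 : 1 < p.
Let p0 : 0 < p. Proof. exact: lt_trans p1. Qed.

(** Plans can be composed, values of [Wp] cannot. Besides, [fine] turns an infinite infimum into 0,
    so a small [Wp] alone does not provide a plan. *)
Definition transport_le (mu nu : probability X R) (c : R) :=
  0 <= c /\ exists2 pi, coupling mu nu pi &
    (\int[pi]_z ((dist z.1 z.2) `^ p)%:E <= (c `^ p)%:E)%E.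

Lemma powRK (c : R) : 0 <= c -> (c `^ p) `^ p^-1 = c.
Proof. by move=> c0; rewrite -powRrM mulfV ?gt_eqF// powRr1. Qed.

Lemma powRVK (c : R) : 0 <= c -> (c `^ p^-1) `^ p = c.
Proof. by move=> c0; rewrite -powRrM mulVf ?gt_eqF// powRr1. Qed.

Lemma measurable_cost : measurable_fun setT (fun z : X * X => (dist z.1 z.2) `^ p).
Proof. exact: (measurableT_comp (measurable_powR p) measurable_dist2). Qed.

Lemma Lnorm_le d (T : measurableType d) (P : probability T R) (f : T -> R) c :
  (forall x, 0 <= f x) -> 0 <= c -> (\int[P]_x (f x `^ p)%:E <= (c `^ p)%:E)%E ->
  (Lnorm P p%:E (EFin \o f) <= c%:E)%E.
Proof.
move=> f0 c0 fc; rewrite unlock.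
rewrite (eq_integral (fun x => (f x `^ p)%:E)); last first.
  by move=> x _; rewrite /= ger0_norm.
rewrite -[in leRHS](powRK c0) -poweR_EFin.
have p'0 : 0 <= p^-1 by rewrite invr_ge0 ltW.
apply: (gt0_ler_poweR p'0) => //; rewrite in_itv/= leey andbT.
  by apply: integral_ge0 => x _; rewrite lee_fin powR_ge0.
by rewrite lee_fin powR_ge0.
Qed.

(** Under the glued plan the two middle points almost surely share a cell. The distance between the
    outer points is thus at most the sum of the two transport distances and [e], and Minkowski's
    inequality bounds its L^p norm. *)
Lemma transport_le_trans (mu1 mu2 mu3 : probability X R) (a b e : R) : 0 < e ->
  transport_le mu1 mu2 a -> transport_le mu2 mu3 b ->
  transport_le mu1 mu3 (a + e + b).
Proof.
move=> e0 [a0 [pi cpi pia]] [b0 [rho crho rhob]].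
split; first by rewrite !addr_ge0// ltW.
have [x0 _] : [set: X] !=set0.
  apply/set0P/eqP => X0; have := probability_setT mu1.
  by rewrite X0 measure0 => /esym/eqP; rewrite onee_eq0.
have [B [mB tB cB Be]] := small_partition x0 e0.
have [|G [G1 G2 G0]] := @glue_along_partition R _ _ _ X X X pi rho B mB tB cB.
  by move=> A mA; have [_ ->] := cpi _ mA; have [->] := crho _ mA.
have mout : measurable_fun setT (fun w : (X * X) * (X * X) => (w.1.1, w.2.2)).
  apply: measurable_fun_pair.
    by apply: measurableT_comp => //; exact: measurableT_comp.
  by apply: measurableT_comp => //; exact: measurableT_comp.
have [gam gamE gamI] := pushforward_probability G mout.
exists gam.
  move=> A mA; rewrite !gamE; split.
    have [<- _] := cpi _ mA; rewrite -G1; last exact: measurableX.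
    by congr (G _); apply/seteqP; split => w /=; tauto.
  have [_ <-] := crho _ mA; rewrite -G2; last exact: measurableX.
  by congr (G _); apply/seteqP; split => w /=; tauto.
rewrite gamI; last 2 first.
- exact: measurable_cost.
- by move=> z; exact: powR_ge0.
have m1 : measurable_fun setT (fun w : (X * X) * (X * X) => dist w.1.1 w.1.2).
  by apply: (measurableT_comp measurable_dist2); exact: measurable_fst.
have m2 : measurable_fun setT (fun w : (X * X) * (X * X) => dist w.2.1 w.2.2).
  by apply: (measurableT_comp measurable_dist2); exact: measurable_snd.
have m3 : measurable_fun setT (fun w : (X * X) * (X * X) => dist w.1.1 w.2.2).
  exact: (measurableT_comp measurable_dist2 mout).
have mmid : measurable_fun setT (fun w : (X * X) * (X * X) => (w.1.2, w.2.1)).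
  apply: measurable_fun_pair.
    by apply: measurableT_comp => //; exact: measurableT_comp.
  by apply: measurableT_comp => //; exact: measurableT_comp.
have m4 : measurable_fun setT (fun w : (X * X) * (X * X) => dist w.1.2 w.2.1).
  exact: (measurableT_comp measurable_dist2 mmid).
pose F1 (w : (X * X) * (X * X)) := dist w.1.1 w.1.2.
pose F2 (w : (X * X) * (X * X)) := dist w.2.1 w.2.2.
have I1 : (\int[G]_w ((F1 w) `^ p)%:E <= (a `^ p)%:E)%E.
  apply: le_trans pia.
  have [fG fGE fGI] := pushforward_probability G measurable_fst.
  rewrite -(fGI (fun z => dist z.1 z.2 `^ p)); last 2 first.
  - exact: measurable_cost.
  - by move=> z; exact: powR_ge0.
  rewrite (eq_measure_integral pi)// => A mA _; transitivity (G (fst @^-1` A)); first exact: fGE.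
  transitivity (G (A `*` setT)); last exact: G1.
  by congr (G _); apply/seteqP; split => w /=; tauto.
have I2 : (\int[G]_w ((F2 w) `^ p)%:E <= (b `^ p)%:E)%E.
  apply: le_trans rhob.
  have [fG fGE fGI] := pushforward_probability G measurable_snd.
  rewrite -(fGI (fun z => dist z.1 z.2 `^ p)); last 2 first.
  - exact: measurable_cost.
  - by move=> z; exact: powR_ge0.
  rewrite (eq_measure_integral rho)// => A mA _; transitivity (G (snd @^-1` A)); first exact: fGE.
  transitivity (G (setT `*` A)); last exact: G2.
  by congr (G _); apply/seteqP; split => w /=; tauto.
have Ie : (\int[G]_w ((cst e w) `^ p)%:E <= (e `^ p)%:E)%E.
  rewrite (eq_integral (cst (e `^ p)%:E)); last by [].
  rewrite integral_cst// [X in (_ * X)%E](_ : _ = 1%E) ?mule1//.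
  exact: probability_setT.
pose F := (F1 \+ cst e) \+ F2.
have F0 w : 0 <= F w.
  by apply: addr_ge0; [apply: addr_ge0; [exact: dist_ge0|exact: (ltW e0)]|exact: dist_ge0].
have mF : measurable_fun setT F.
  by apply: measurable_funD => //; exact: measurable_funD.
have NF : (Lnorm G p%:E (EFin \o F) <= (a + e + b)%:E)%E.
  rewrite !EFinD; apply: le_trans (minkowski_EFin _ _ _ (ltW p1)) _ => //.
    exact: measurable_funD.
  apply: leeD; last by apply: Lnorm_le => // w; exact: dist_ge0.
  apply: le_trans (minkowski_EFin _ _ _ (ltW p1)) _ => //.
  apply: leeD; apply: Lnorm_le => //.
  - by move=> w; exact: dist_ge0.
  - by move=> w; exact: ltW.
  - exact: ltW.
have -> : ((a + e + b) `^ p)%:E = (((a + e + b)%:E `^ p)%E : \bar R).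
  by rewrite poweR_EFin.
have FI : (\int[G]_w ((F w) `^ p)%:E <= (a + e + b)%:E `^ p)%E.
  have -> : (\int[G]_w ((F w) `^ p)%:E = Lnorm G p%:E (EFin \o F) `^ p)%E.
    rewrite poweR_Lnorm ?gt_eqF//; apply: eq_integral => w _.
    by rewrite /= ger0_norm.
  apply: (gt0_ler_poweR (ltW p0)) => //; rewrite in_itv/= leey andbT.
    exact: Lnorm_ge0.
  by rewrite lee_fin !addr_ge0// ltW.
apply: le_trans FI; apply: ae_ge0_le_integral => //.
- by move=> w _; rewrite lee_fin powR_ge0.
- by apply/measurable_EFinP; apply: (measurableT_comp (measurable_powR p)).
- by move=> w _; rewrite lee_fin powR_ge0.
- by apply/measurable_EFinP; apply: (measurableT_comp (measurable_powR p)).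
(* Two middle points at distance at least [e] share no cell, so this set is null for [G]. *)
exists [set w | e <= dist w.1.2 w.2.1]; split.
- rewrite -[X in measurable X]setTI.
  rewrite (_ : [set w | _] = (fun w : (X * X) * (X * X) => dist w.1.2 w.2.1) @^-1` `[e, +oo[).
    by apply: m4 => //; exact: measurable_itv.
  by apply/seteqP; split => z /=; rewrite in_itv/= andbT.
- apply: G0.
    rewrite -[X in measurable X]setTI.
    rewrite (_ : [set w | _] = (fun w : (X * X) * (X * X) => dist w.1.2 w.2.1) @^-1` `[e, +oo[).
      by apply: m4 => //; exact: measurable_itv.
    by apply/seteqP; split => z /=; rewrite in_itv/= andbT.
  by move=> w i /= ew /Be /[apply]; rewrite ltNge ew.
- move=> w /= nw; rewrite leNgt; apply/negP => we; apply: nw => _.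
  rewrite lee_fin; apply: (ge0_ler_powR (ltW p0)); rewrite ?nnegrE//.
  have := dist_tri w.1.1 w.1.2 w.2.2; have := dist_tri w.1.2 w.2.1 w.2.2.
  rewrite /F /F1 /F2 /=; move: we; lra.
Qed.

(** The plan is the law of [(f, g)] under [mu]. This covers the diagonal plan and every plan onto a
    Dirac mass used below. *)
Lemma transport_le_map (mu : probability X R) (f g : X -> X) (nu1 nu2 : probability X R) c :
  measurable_fun setT f -> measurable_fun setT g -> 0 <= c ->
  (forall A, measurable A -> nu1 A = mu (f @^-1` A)) ->
  (forall A, measurable A -> nu2 A = mu (g @^-1` A)) ->
  (\int[mu]_x ((dist (f x) (g x)) `^ p)%:E <= (c `^ p)%:E)%E ->
  transport_le nu1 nu2 c.
Proof.
move=> mf mg c0 fE gE fgc; split => //.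
have [pi piE piI] := pushforward_probability mu (measurable_fun_pair mf mg).
exists pi.
  move=> A mA; rewrite !piE fE// gE//.
  by split; congr (mu _); apply/seteqP; split => x /=; tauto.
rewrite piI//; first exact: measurable_cost.
by move=> z; exact: powR_ge0.
Qed.

Lemma transport_le_refl mu : transport_le mu mu 0.
Proof.
apply: (@transport_le_map mu idfun idfun) => //; try exact: measurable_id.
rewrite powR0 ?gt_eqF// integral0_eq// => x _ /=.
by rewrite (dist_eq0 x x).2// powR0 ?gt_eqF.
Qed.

Lemma transport_le_sym mu nu c : transport_le mu nu c -> transport_le nu mu c.
Proof.
move=> [c0 [pi cpi pic]]; split => //.
have msw : measurable_fun setT (fun z : X * X => (z.2, z.1)).
  exact: measurable_fun_pair.
have [gam gamE gamI] := pushforward_probability pi msw.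
exists gam.
  move=> A mA; rewrite !gamE; have [<- <-] := cpi _ mA.
  by split; congr (pi _); apply/seteqP; split => x /=; tauto.
rewrite gamI; last 2 first.
- exact: measurable_cost.
- by move=> z; exact: powR_ge0.
by under eq_integral do rewrite /= distC.
Qed.

Lemma transport_le_center mu : Pp dist p mu ->
  exists x0 c, transport_le mu (\d_x0) c.
Proof.
move=> [x0]; set I := (\int[mu]_x _)%E => Ioo.
have I0 : (0 <= I)%E by apply: integral_ge0 => x _; rewrite lee_fin powR_ge0.
exists x0, (fine I `^ p^-1).
apply: (@transport_le_map mu idfun (cst x0)) => //.
- exact: measurable_id.
- exact: powR_ge0.
  move=> A mA; rewrite /= diracE; case: (boolP (x0 \in A)); rewrite ?inE ?notin_setE => xA.
    rewrite (_ : _ @^-1` _ = setT) ?probability_setT//.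
    by apply/seteqP; split.
  rewrite (_ : _ @^-1` _ = set0) ?measure0//.
  by apply/seteqP; split.
rewrite powRVK ?fine_ge0// fineK ?ge0_fin_numE//.
by under eq_integral do rewrite /= distC.
Qed.

Lemma transport_le_dirac x y : exists c, transport_le (\d_x) (\d_y) c.
Proof.
exists (dist x y); apply: (@transport_le_map (\d_x) idfun (cst y)) => //.
  exact: measurable_id.
rewrite integral_dirac//; last first.
  apply/measurable_EFinP; apply: (measurableT_comp (measurable_powR p)).
  by under eq_fun do rewrite /= distC; exact: measurable_dist1.
by rewrite diracT mul1e.
Qed.

(** The route passes through Dirac masses at the two centres; each [1] in the witness is an
    arbitrary gluing loss. Finiteness keeps [fine] in [Wp] away from its default value. *)
Lemma transport_finite mu nu : Pp dist p mu -> Pp dist p nu ->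
  exists c, transport_le mu nu c.
Proof.
move=> /transport_le_center[x [a mua]] /transport_le_center[y [b nub]].
have [c xyc] := transport_le_dirac x y.
exists (a + 1 + c + 1 + b).
apply: transport_le_trans (transport_le_sym nub) => //.
exact: transport_le_trans xyc.
Qed.

Let cost mu nu := ereal_inf [set (\int[pi]_z ((dist z.1 z.2) `^ p)%:E)%E
                   | pi in coupling mu nu].

Let cost_ge0 mu nu : (0 <= cost mu nu)%E.
Proof.
apply: le_ereal_inf_tmp => _ [pi _ <-].
by apply: integral_ge0 => x _; rewrite lee_fin powR_ge0.
Qed.

Lemma Wp_ge0 mu nu : 0 <= Wp dist p mu nu.
Proof. exact: powR_ge0. Qed.

Lemma Wp_le mu nu c : transport_le mu nu c -> Wp dist p mu nu <= c.
Proof.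
move=> [c0 [pi cpi pic]]; rewrite /Wp -/(cost mu nu).
have h : (cost mu nu <= (c `^ p)%:E)%E.
  by apply: le_trans pic; apply: ereal_inf_lbound; exists pi.
rewrite -[leRHS](powRK c0).
have p'0 : 0 <= p^-1 by rewrite invr_ge0 ltW.
apply: (ge0_ler_powR p'0); rewrite ?nnegrE ?powR_ge0 ?fine_ge0//.
by rewrite -lee_fin fineK// ge0_fin_numE// (le_lt_trans h)// ltry.
Qed.

(** The strict inequality leaves room for a plan between the infimum and [c]; the moment conditions
    make this infimum finite. *)
Lemma transport_Wp_lt mu nu c : Pp dist p mu -> Pp dist p nu ->
  Wp dist p mu nu < c -> transport_le mu nu c.
Proof.
move=> /transport_finite /[apply] -[c' [c'0 [pi' cpi' pic']]] Wc.
have c0 : 0 <= c by apply: le_trans (ltW Wc); exact: Wp_ge0.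
have fin : cost mu nu \is a fin_num.
  rewrite ge0_fin_numE//.
  apply: (@le_lt_trans _ _ ((c' `^ p)%:E)); last exact: ltry.
  by apply: le_trans pic'; apply: ereal_inf_lbound; exists pi'.
have : (cost mu nu < (c `^ p)%:E)%E.
  rewrite -(fineK fin) lte_fin -[ltLHS]powRVK ?fine_ge0//.
  by apply: (gt0_ltr_powR p0); rewrite ?nnegrE// Wp_ge0.
move=> /ereal_inf_lt[_ [pi cpi <-] pic]; split => //; exists pi => //.
exact: ltW.
Qed.

Lemma Wp_refl mu : Wp dist p mu mu = 0.
Proof.
by apply/eqP; rewrite eq_le Wp_ge0 andbT; apply: Wp_le; exact: transport_le_refl.
Qed.

Lemma Wp_sym mu nu : Pp dist p mu -> Pp dist p nu ->
  Wp dist p mu nu = Wp dist p nu mu.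
Proof.
have H m n : Pp dist p m -> Pp dist p n -> Wp dist p m n <= Wp dist p n m.
  move=> Pm Pn; apply/ler_addgt0Pr => e e0; apply: Wp_le; apply: transport_le_sym.
  by apply: transport_Wp_lt => //; rewrite ltrDl.
by move=> Pmu Pnu; apply/eqP; rewrite eq_le !H.
Qed.

Lemma Wp_triangle mu nu lam : Pp dist p mu -> Pp dist p nu -> Pp dist p lam ->
  Wp dist p mu lam <= Wp dist p mu nu + Wp dist p nu lam.
Proof.
move=> Pmu Pnu Plam; apply/ler_addgt0Pr => e e0.
(* One third for each of the two plans and one for the gluing loss. *)
have e3 : 0 < e / 3 by rewrite divr_gt0.
have h1 : transport_le mu nu (Wp dist p mu nu + e / 3).
  by apply: transport_Wp_lt => //; rewrite ltrDl.
have h2 : transport_le nu lam (Wp dist p nu lam + e / 3).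
  by apply: transport_Wp_lt => //; rewrite ltrDl.
apply: le_trans (Wp_le (transport_le_trans e3 h1 h2)) _.
lra.
Qed.

(** * The Prokhorov metric and its comparison with the Wasserstein distance *)

Definition prokhorov_le (mu nu : probability X R) (e : R) :=
  0 < e /\ forall A : set X, measurable A ->
         (mu A <= nu (enlarge dist A e) + e%:E)%E /\
         (nu A <= mu (enlarge dist A e) + e%:E)%E.

Lemma prokhorov_le1 mu nu : prokhorov_le mu nu 1.
Proof.
split => // A mA; split.
  by rewrite (le_trans (probability_le1 _ mA))// leeDr.
by rewrite (le_trans (probability_le1 _ mA))// leeDr.
Qed.

Lemma dLP_le mu nu e : prokhorov_le mu nu e -> dLP dist mu nu <= e.
Proof.
move=> H; apply: ge_inf => //; exists 0 => x [x0 _]; exact: ltW.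
Qed.

Lemma dLP_lt mu nu e : dLP dist mu nu < e -> exists2 e', e' < e & prokhorov_le mu nu e'.
Proof.
move=> /inf_lt; case; first by exists 1; exact: prokhorov_le1.
by move=> e' H e'e; exists e'.
Qed.

Lemma dLP_ge0 mu nu : 0 <= dLP dist mu nu.
Proof.
apply: lb_le_inf; first by exists 1; exact: prokhorov_le1.
by move=> x [x0 _]; exact: ltW.
Qed.

Lemma dLP_sym mu nu : dLP dist mu nu = dLP dist nu mu.
Proof.
by congr inf; apply/seteqP; split => e [e0 H]; split => // A mA; have [] := H A mA.
Qed.

(** Admissible radii add up, because enlarging twice stays inside the enlargement by the sum. The
    strict bounds provide admissible radii below [a] and [b]. *)
Lemma dLP_triangle_lt mu nu lam a b : dLP dist mu nu < a -> dLP dist nu lam < b ->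
  dLP dist mu lam < a + b.
Proof.
move=> /dLP_lt[a' a'a [a'0 Ha]] /dLP_lt[b' b'b [b'0 Hb]].
apply: (@le_lt_trans _ _ (a' + b')); last by rewrite ltrD.
apply: dLP_le; split; first by rewrite addr_gt0.
have mE := measurable_enlarge.
move=> A mA; split.
  have [H1 _] := Ha A mA; have [H2 _] := Hb _ (mE A a').
  apply: le_trans H1 _; apply: (le_trans (leeD2r _ H2)).
  rewrite -addeA -EFinD (addrC b') leeD2r//.
  apply: le_measure; rewrite ?inE// => x [y [z Az yz] xy]; exists z => //.
  by have := dist_tri x y z; move: xy yz; lra.
have [_ H1] := Hb A mA; have [_ H2] := Ha _ (mE A b').
apply: le_trans H1 _; apply: (le_trans (leeD2r _ H2)).
rewrite -addeA -EFinD leeD2r//.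
apply: le_measure; rewrite ?inE// => x [y [z Az yz] xy]; exists z => //.
by have := dist_tri x y z; move: xy yz; lra.
Qed.

(** Markov's inequality: under a plan of cost at most e^(p+1), the two points are at distance at
    least [e] with probability at most [e], which is the Prokhorov condition. The threshold is
    uniform in the two measures. *)
Lemma Wp_dLP e : 0 < e -> exists2 d, 0 < d & forall mu nu,
  Pp dist p mu -> Pp dist p nu -> Wp dist p mu nu < d -> dLP dist mu nu <= e.
Proof.
move=> e0; exists ((e * e `^ p) `^ p^-1).
  by rewrite powR_gt0// mulr_gt0// powR_gt0.
move=> mu nu Pmu Pnu /(transport_Wp_lt Pmu Pnu)[_ [pi cpi]].
have ep0 : 0 < e `^ p by rewrite powR_gt0.
rewrite powRVK; last by rewrite mulr_ge0 ?powR_ge0// ltW.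
move=> pie; set S := [set z : X * X | e <= dist z.1 z.2].
have mS : measurable S.
  rewrite -[X in measurable X]setTI (_ : S = (fun z : X * X => dist z.1 z.2) @^-1` `[e, +oo[).
    by apply: measurable_dist2 => //; exact: measurable_itv.
  by apply/seteqP; split => z /=; rewrite in_itv/= andbT.
have piS : (pi S <= e%:E)%E.
  have : ((e `^ p)%:E * pi S <= (e `^ p)%:E * e%:E)%E.
    rewrite -[X in pi X]setIT -integral_indic// -ge0_integralZl_EFin//; last 2 first.
    - exact/measurable_EFinP/measurable_indic.
    - exact: ltW.
    rewrite -EFinM mulrC; apply: le_trans pie.
    apply: ge0_le_integral => //.
    - by move=> z _; rewrite -EFinM lee_fin mulr_ge0// powR_ge0.
    - under eq_fun do rewrite -EFinM.
      by apply/measurable_EFinP; apply: measurable_funM => //; exact: measurable_indic.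
    - by apply/measurable_EFinP; exact: measurable_cost.
    move=> z _; rewrite -EFinM lee_fin indicE.
    case: (boolP (z \in S)); rewrite ?inE => zS /=; last by rewrite mulr0 powR_ge0.
    rewrite mulr1; apply: (ge0_ler_powR (ltW p0)); rewrite ?nnegrE//.
    exact: ltW.
  by rewrite lee_pmul2l.
apply: dLP_le; split => // A mA; split.
  have [<- _] := cpi A mA; have [_ <-] := cpi _ (measurable_enlarge A e).
  apply: le_trans (leeD2l _ piS).
  apply: le_trans (measureU2 _ _ _) => //; last by apply: measurableX => //; exact: measurable_enlarge.
  apply: le_measure; rewrite ?inE//; first exact: measurableX.
    by apply: measurableU => //; apply: measurableX => //; exact: measurable_enlarge.
  move=> [x y] [/= Ax _]; have [exy|xye] := leP e (dist x y); first by right.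
  by left; split => //; exists x => //; rewrite distC.
have [_ <-] := cpi A mA; have [<- _] := cpi _ (measurable_enlarge A e).
apply: le_trans (leeD2l _ piS).
apply: le_trans (measureU2 _ _ _) => //; last by apply: measurableX => //; exact: measurable_enlarge.
apply: le_measure; rewrite ?inE//; first exact: measurableX.
  by apply: measurableU => //; apply: measurableX => //; exact: measurable_enlarge.
move=> [x y] [/= _ Ay]; have [exy|xye] := leP e (dist x y); first by right.
by left; split => //; exists y.
Qed.

End Wasserstein.

(** * Metric derivative of an absolutely continuous curve *)

Section absolute_continuity.
Context {R : realType}.
Local Notation leb := (@lebesgue_measure R).
Implicit Types w f h : R -> R.

Lemma integrable_itv w (i : interval R) :
  leb.-integrable setT (EFin \o w) -> leb.-integrable [set` i] (EFin \o w).
Proof. by apply: integrableS => //; exact: measurable_itv. Qed.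

Definition prim w (t : R) : R := \int[leb]_(x in `]-oo, t]) w x.

Lemma prim_itv w (s t : R) : leb.-integrable setT (EFin \o w) -> s <= t ->
  prim w t - prim w s = \int[leb]_(x in `]s, t]) w x.
Proof.
move=> iw st; rewrite /prim Rintegral_itvB ?bnd_simp//.
exact: integrable_itv.
Qed.

Lemma le_Rintegral_itv w w' (i : interval R) :
  leb.-integrable setT (EFin \o w) -> leb.-integrable setT (EFin \o w') ->
  (forall x, w x <= w' x) ->
  \int[leb]_(x in [set` i]) w x <= \int[leb]_(x in [set` i]) w' x.
Proof.
move=> iw iw' ww'; by apply: le_Rintegral => //; exact: integrable_itv.
Qed.

Lemma prim_small w (e : R) : leb.-integrable setT (EFin \o w) -> 0 < e ->
  exists2 d : R, 0 < d & forall s t, s <= t -> t - s < d ->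
    \int[leb]_(x in `]s, t]) `|w x| < e.
Proof.
move=> iw e0; have [d [d0 H]] := integral_normr_continuous iw e0.
exists d => // s t st tsd; apply: H; first exact: measurable_itv.
rewrite /= lebesgue_measure_itv/= lte_fin; case: ifPn => // _.
Qed.

Section density.
Variables (w f : R -> R).
Hypothesis iw : leb.-integrable setT (EFin \o w).
Hypothesis w0 : forall x, 0 <= w x.
Hypothesis fw : forall s t, s <= t -> `|f t - f s| <= \int[leb]_(x in `]s, t]) w x.

(** Right continuity follows from the absolute continuity of the integral of [w]. The factor 2
    accommodates [M + f], [M - f] and [M + M], where [M] is the primitive of [w]. *)
Lemma cumulative_dominated g :
  (forall s t, s <= t -> 0 <= g t - g s <= (\int[leb]_(x in `]s, t]) w x) *+ 2) ->
  exists G : cumulative R R, G = g :> (R -> R).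
Proof.
move=> H.
have nd : nondecreasing g.
  by move=> s t st; rewrite -subr_ge0; have /andP[] := H _ _ st.
have rc : right_continuous g.
  move=> s; apply/cvgrPdist_lt => e e0.
  have [d d0 Hd] := prim_small iw (divr_gt0 e0 (ltr0n R 2)).
  near=> t.
  have st : s <= t by apply/ltW; near: t; exact: nbhs_right_gt.
  have tsd : t - s < d.
    by rewrite ltrBlDl; near: t; apply: nbhs_right_lt; rewrite ltrDl.
  have /andP[g0 g1] := H _ _ st.
  rewrite distrC ger0_norm//; apply: (le_lt_trans g1).
  rewrite mulr2n [ltRHS]splitr.
  have := Hd _ _ st tsd.
  have -> : \int[leb]_(x in `]s, t]) `|w x| = \int[leb]_(x in `]s, t]) w x.
    by apply: eq_Rintegral => x _; rewrite ger0_norm.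
  by move=> ?; rewrite ltrD.
pose G : cumulative R R := HB.pack g (isCumulative.Build R _ R g nd rc).
by exists G.
Unshelve. all: by end_near. Qed.

Lemma lebesgue_stieltjes_ocitv (G : cumulative R R) a b : a <= b ->
  lebesgue_stieltjes_measure G `]a, b] = (G b - G a)%:E.
Proof.
move=> ab; rewrite /lebesgue_stieltjes_measure /measure_extension/=.
rewrite measurable_mu_extE/=; last exact: is_ocitv.
by rewrite wlength_itv_bnd.
Qed.

(** Adding the primitive [M] of [w] makes [f] nondecreasing, so that [M + f] defines a measure.
    Radon-Nikodym gives this measure a density [k], and [k - w] is a density for [f]. *)
Lemma absolutely_continuous_density : exists2 h : R -> R,
  leb.-integrable setT (EFin \o h) &
  forall s t, s <= t -> f t - f s = \int[leb]_(x in `]s, t]) h x.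
Proof.
pose M := prim w.
have ME s t : s <= t -> M t - M s = \int[leb]_(x in `]s, t]) w x by exact: prim_itv.
have [gp gpE] : exists G : cumulative R R, G = (fun t => M t + f t) :> (R -> R).
  apply: cumulative_dominated => s t st; have := fw st; rewrite -ME// ler_norml.
  by move=> /andP[? ?]; apply/andP; split; rewrite ?mulr2n; lra.
have [gm gmE] : exists G : cumulative R R, G = (fun t => M t - f t) :> (R -> R).
  apply: cumulative_dominated => s t st; have := fw st; rewrite -ME// ler_norml.
  by move=> /andP[? ?]; apply/andP; split; rewrite ?mulr2n; lra.
have [gs gsE] : exists G : cumulative R R, G = (fun t => M t + M t) :> (R -> R).
  apply: cumulative_dominated => s t st; have := fw st; rewrite -ME//.
  by move=> /(le_trans (normr_ge0 _)) ?; apply/andP; split; rewrite ?mulr2n; lra.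
(* The Stieltjes measures of M + f and M - f add up to the measure of density 2 w,
   so each of them is absolutely continuous. *)
pose np := lebesgue_stieltjes_measure gp.
pose nm := lebesgue_stieltjes_measure gm.
have iww : leb.-integrable setT (EFin \o (fun x => w x + w x)).
  by have := integrableD measurableT iw iw; apply: eq_integrable.
have c0 A : (0 <= induced_charge iww A)%E.
  by apply: integral_ge0 => x _; rewrite lee_fin addr_ge0.
have sumE A : measurable A -> lebesgue_stieltjes_measure gs A = (np A + nm A)%E.
  move=> mA; rewrite -measure_addE.
  apply: lebesgue_stieltjes_measure_unique => // X /ocitvP[->|[[a b]/= ab ->]].
    by rewrite !measure0.
  rewrite /= /msum !big_ord_recl big_ord0 adde0/=.
  rewrite !lebesgue_stieltjes_ocitv ?ltW// -EFinD gsE gpE gmE.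
  by congr (_%:E); ring.
have intE A : measurable A ->
    lebesgue_stieltjes_measure gs A = measure_of_charge _ c0 A.
  move=> mA.
  apply: lebesgue_stieltjes_measure_unique => // X /ocitvP[->|[[a b]/= ab ->]].
    by rewrite !measure0.
  rewrite lebesgue_stieltjes_ocitv ?ltW// gsE /measure_of_charge/= /induced_charge.
  have iab := integrable_itv `]a, b] iww.
  rewrite -[RHS]fineK; last exact: integrable_fin_num.
  congr (_%:E); rewrite -/(Rintegral _ _ _) RintegralD//; last 2 first.
    exact: integrable_itv.
    exact: integrable_itv.
  by rewrite -ME ?ltW//; ring.
have npE A : measurable A -> (np A <= \int[leb]_(x in A) (w x + w x)%:E)%E.
  by move=> mA; rewrite -[leRHS]/(measure_of_charge _ c0 A) -intE// sumE//; exact: leeDl.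
have npT : (np setT < +oo)%E.
  apply: le_lt_trans (npE _ measurableT) _.
  rewrite ltey_eq; apply/orP; left; exact: integrable_fin_num.
(* Restricting to [setT] leaves [np] unchanged but equips it with the finite measure structure that
   Radon-Nikodym requires. *)
have dom : mfrestr measurableT npT `<< leb.
  apply/null_content_dominatesP => A mA A0.
  apply/eqP; rewrite /mfrestr /mrestr setIT eq_le measure_ge0 andbT.
  apply: (le_trans (npE _ mA)).
  rewrite null_set_integral//.
  exact: measurable_int (integrableS measurableT mA (@subsetT _ _) iww).
have [k [k0 kfin ik kE]] := radon_nikodym_sigma_finite dom.
have ik' : leb.-integrable setT (EFin \o (fine \o k)).
  by apply: eq_integrable ik => // x _ /=; rewrite fineK.
exists (fun x => fine (k x) - w x).
  by have := integrableB measurableT ik' iw; apply: eq_integrable.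
move=> s t st; rewrite RintegralB//; last 2 first.
- exact: integrable_itv.
- exact: integrable_itv.
rewrite -ME// [X in _ = X - _](_ : _ = gp t - gp s).
  by rewrite gpE; ring.
rewrite /Rintegral -[RHS]/(fine (gp t - gp s)%:E); congr fine.
rewrite -lebesgue_stieltjes_ocitv//.
have := kE `]s, t]%classic (measurable_itv _).
rewrite /= /mfrestr /mrestr setIT => ->.
by apply: eq_integral => x _ /=; rewrite fineK.
Qed.
End density.

End absolute_continuity.

(** * Almost everywhere existence of the metric derivative *)

Section metric_derivative.
Context {R : realType}.
Local Notation leb := (@lebesgue_measure R).

Lemma measurable_fun_integrable (g : R -> R) :
  leb.-integrable setT (EFin \o g) -> measurable_fun setT g.
Proof. by move=> ig; apply/measurable_EFinP; exact: (measurable_int leb). Qed.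

Lemma aeS (P Q : R -> Prop) : {ae leb, forall t, P t} ->
  (forall t, P t -> Q t) -> {ae leb, forall t, Q t}.
Proof.
by move=> + PQ; apply: filterS; first exact: (ae_filter_ringOfSetsType leb).
Qed.

Lemma aeS2 (P Q S : R -> Prop) : {ae leb, forall t, P t} -> {ae leb, forall t, Q t} ->
  (forall t, P t -> Q t -> S t) -> {ae leb, forall t, S t}.
Proof.
move=> aP aQ PQ; apply: filterS2 PQ aP aQ.
exact: (ae_filter_ringOfSetsType leb).
Qed.

Lemma cvg_sub_dnbhs (t : R) : s - t @[s --> t^'] --> 0^'.
Proof.
move=> P [e /= e0 He]; exists e => //= s ts st; apply: He.
  by rewrite /ball/= sub0r normrN distrC.
by rewrite subr_eq0.
Qed.

Lemma prim_derive (g : R -> R) : leb.-integrable setT (EFin \o g) ->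
  {ae leb, forall t, (prim g s - prim g t) / (s - t) @[s --> t^'] --> g t}.
Proof.
move=> ig; apply: (aeS (FTC1Ny (fun y => integrable_itv `]-oo, y] ig)
  (open_integrable_locally openT ig))) => t /= [dg <-].
have {}dg : (h^-1 *: (prim g (h *: 1 + t) - prim g t)) @[h --> 0^'] -->
   (prim g)^`()%classic t.
  by rewrite derive1E; exact: dg.
have := cvg_comp _ _ (@cvg_sub_dnbhs t) dg.
apply: cvg_trans; apply: near_eq_cvg; near=> s => /=.
by rewrite [_%:A]mulr1 subrK [RHS]mulrC.
Unshelve. all: by end_near. Qed.

(** Differentiating both primitives gives [|h| <= w] almost everywhere. Truncation to [[-w, w]]
    extends the bound to every point, so that a supremum of countably many such densities is finite
    everywhere. *)
Lemma absolutely_continuous_bounded_density (w f : R -> R) :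
  leb.-integrable setT (EFin \o w) -> (forall x, 0 <= w x) ->
  (forall s t, s <= t -> `|f t - f s| <= \int[leb]_(x in `]s, t]) w x) ->
  exists h : R -> R, [/\ leb.-integrable setT (EFin \o h),
    forall x, `|h x| <= w x &
    forall s t, s <= t -> f t - f s = \int[leb]_(x in `]s, t]) h x].
Proof.
move=> iw w0 fw; have [h ih fh] := absolutely_continuous_density iw w0 fw.
have hw : {ae leb, forall t, `|h t| <= w t}.
  apply: (aeS2 (prim_derive iw) (prim_derive ih)) => t /= wt ht.
  have {}wt := @cvg_norm _ _ _ _ (dnbhs_filter t) _ _ wt; have {}ht := @cvg_norm _ _ _ _ (dnbhs_filter t) _ _ ht.
  rewrite -(ger0_norm (w0 t)).
  apply: (ler_cvg_to ht wt); near=> s.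
  rewrite !normrM ler_wpM2r//.
  have le_prim a b : a <= b -> `|prim h b - prim h a| <= `|prim w b - prim w a|.
    by move=> ab; rewrite !prim_itv// -fh// (le_trans (fw _ _ ab))// ler_norm.
  have /orP[st|ts] := le_total s t; last exact: le_prim.
  by rewrite distrC [leRHS]distrC; exact: le_prim.
have mh := measurable_fun_integrable ih.
have mw := measurable_fun_integrable iw.
pose k x := Num.max (- w x) (Num.min (h x) (w x)).
have kw x : `|k x| <= w x.
  by rewrite /k ler_norml le_max ge_max lexx/= ge0_cp ?w0//= ge_min lexx orbT.
have mk : measurable_fun setT k.
  apply: measurable_maxr; first exact: measurableT_comp.
  exact: measurable_minr.
have ik : leb.-integrable setT (EFin \o k).
  apply: le_integrable iw => //; first exact/measurable_EFinP.
  by move=> x _; rewrite lee_fin (ger0_norm (w0 x)).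
exists k; split => // s t st; rewrite fh// /Rintegral; congr fine.
apply: ae_eq_integral => //.
- exact: measurable_int (integrable_itv `]s, t] ih).
- exact: measurable_int (integrable_itv `]s, t] ik).
apply: (aeS hw) => x hx _ /=; congr (_%:E).
by move: hx; rewrite ler_norml /k => /andP[? ?]; rewrite min_l// max_r.
Unshelve. all: by end_near. Qed.

Variables (om : R -> R -> R) (w : R -> R).
Hypothesis om_sym : forall s t, om s t = om t s.
Hypothesis om_tri : forall s t u, om s u <= om s t + om t u.
Hypothesis iw : leb.-integrable setT (EFin \o w).
Hypothesis w0 : forall x, 0 <= w x.
Hypothesis omw : forall s t, s <= t -> om s t <= \int[leb]_(x in `]s, t]) w x.

Let om_lip s t a : `|om t a - om s a| <= om s t.
Proof.
have h1 := om_tri t s a; have h2 := om_tri s t a; have h3 := om_sym s t.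
by rewrite ler_norml; apply/andP; split; lra.
Qed.

(** Times running through the rationals. The points of the curve at these times are dense in the
    curve and serve as reference points. *)
Let node (n : nat) : R := if unpickle n is Some q then ratr q else 0.

Let node_dense a b : a < b -> exists n, a < node n < b.
Proof.
move=> /rat_in_itvoo[q]; rewrite in_itv/= => qab; exists (pickle q).
by rewrite /node pickleK.
Qed.

(** The quotient is bounded above by that of the primitive of [D]. It is bounded below by the
    quotients of the functions [om _ (node n)], which are 1-Lipschitz for [om] and whose derivatives
    come, in modulus, arbitrarily close to [D t]. *)
Theorem metric_derivative : exists D : R -> R,
  [/\ leb.-integrable setT (EFin \o D), forall x, 0 <= D x,
      forall s t, s <= t -> om s t <= \int[leb]_(x in `]s, t]) D x &
      {ae leb, forall t, om t s / `|t - s| @[s --> t^'] --> D t}].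
Proof.
have /choice[h /all_and3[ih hw fh]] : forall n, exists h : R -> R,
    [/\ leb.-integrable setT (EFin \o h), forall x, `|h x| <= w x &
      forall s t, s <= t ->
        om t (node n) - om s (node n) = \int[leb]_(x in `]s, t]) h x].
  move=> n; apply: (@absolutely_continuous_bounded_density w (fun t => om t (node n))) => //.
  by move=> s t st; apply: le_trans (omw st); exact: om_lip.
(* The supremum, over a dense sequence r_n, of the derivatives of t |-> om t r_n. *)
pose D x := sups (fun n => `|h n x|) 0%N.
have ubD x : has_ubound (range (fun n => `|h n x|)).
  by exists (w x) => _ [n _ <-]; exact: hw.
have ubD' x : has_ubound (sdrop (fun n => `|h n x|) 0%N).
  by exists (w x) => _ [n _ <-]; exact: hw.
have neD' x : sdrop (fun n => `|h n x|) 0%N !=set0 by exists `|h 0%N x|, 0%N.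
have hD n x : `|h n x| <= D x by apply: ub_le_sup => //; exists n.
have D0 x : 0 <= D x by apply: le_trans (hD 0%N x).
have Dw x : D x <= w x by apply: ge_sup => // _ [n _ <-]; exact: hw.
have mD : measurable_fun setT D.
  apply: (measurable_fun_sups (h := fun n x => `|h n x|)) => [//|n].
  by apply: measurableT_comp => //; exact: measurable_fun_integrable.
have iD : leb.-integrable setT (EFin \o D).
  apply: le_integrable iw => //; first exact/measurable_EFinP.
  by move=> x _; rewrite lee_fin !ger0_norm.
have omD s t : s <= t -> om s t <= \int[leb]_(x in `]s, t]) D x.
  move=> st; apply/ler_addgt0Pr => e e0.
  (* A node shortly after [s] replaces [s] as reference point; its distance to [s] is paid twice,
     hence [e / 2]. *)
  have [d d0 Hd] := prim_small iw (divr_gt0 e0 (ltr0n R 2)).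
  have [|n /andP[sn ns]] := @node_dense s (s + d); first by rewrite ltrDl.
  have sne : om s (node n) < e / 2.
    apply: le_lt_trans (Hd _ _ (ltW sn) _); last by rewrite ltrBlDl.
    apply: le_trans (omw (ltW sn)) _.
    by apply: le_Rintegral => // [||x _]; [exact: integrable_itv|
      exact: integrable_norm (integrable_itv _ iw)|exact: ler_norm].
  have fD : om t (node n) - om s (node n) <= \int[leb]_(x in `]s, t]) D x.
    rewrite fh//; apply: le_Rintegral_itv => // x.
    exact: le_trans (ler_norm _) (hD n x).
  have := om_tri t (node n) s; rewrite (om_sym t s) (om_sym (node n)).
  move: fD sne; lra.
exists D; split => //.
have Hh : {ae leb, forall t, forall n,
    (prim (h n) s - prim (h n) t) / (s - t) @[s --> t^'] --> h n t}.
  by apply: ae_foralln => n; exact: prim_derive.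
apply: (aeS2 Hh (prim_derive iD)) => t /= ht Dt.
have {}Dt := @cvg_norm _ _ _ _ (dnbhs_filter t) _ _ Dt.
rewrite (ger0_norm (D0 t)) in Dt.
apply/cvgrPdist_lt => e e0.
have [_ [n _ <-] hn] := sup_adherent (divr_gt0 e0 (ltr0n R 2)) (conj (neD' t) (ubD' t)).
have {}hn : D t - e / 2 < `|h n t| by exact: hn.
have {}ht := @cvg_norm _ _ _ _ (dnbhs_filter t) _ _ (ht n).
have upper s : om t s <= `|prim D s - prim D t|.
  have /orP[st|ts] := le_total s t.
    by rewrite distrC prim_itv// om_sym (le_trans (omD _ _ st))// ler_norm.
  by rewrite prim_itv// (le_trans (omD _ _ ts))// ler_norm.
have lower s : `|prim (h n) s - prim (h n) t| <= om t s.
  have /orP[st|ts] := le_total s t.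
    by rewrite distrC prim_itv// -fh// [leRHS]om_sym.
  by rewrite prim_itv// -fh.
move/cvgrPdist_lt : Dt => /(_ _ e0) Dt.
move/cvgrPdist_lt : ht => /(_ _ (divr_gt0 e0 (ltr0n R 2))) ht.
near=> s.
have [Ds hs] : `|D t - `|(prim D s - prim D t) / (s - t)| | < e /\
   `| `|h n t| - `|(prim (h n) s - prim (h n) t) / (s - t)| | < e / 2.
  by split; [near: s; exact: Dt|near: s; exact: ht].
have st0 : 0 <= `|s - t|^-1 by rewrite invr_ge0.
have := ler_wpM2r st0 (upper s); have := ler_wpM2r st0 (lower s).
rewrite (distrC t s); move: Ds hs hn.
rewrite !normrM !normfV !ltr_norml => /andP[D1 D2] /andP[h1 h2] hn l u.
apply/andP; split; lra.
Unshelve. all: by end_near. Qed.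

End metric_derivative.

(** * The integral of the derivative of a monotone function *)

Section monotone.
Context {R : realType}.
Local Notation leb := (@lebesgue_measure R).

Lemma lebesgue_measure_shift (c : R) (A : set R) : measurable A ->
  pushforward leb (fun x : measurableTypeR R => x + c : measurableTypeR R) A = leb A.
Proof.
move=> mA; apply/esym/lebesgue_measure_unique => //=.
  exact: measurable_funD.
move=> _ _ [[a b]] _ <-.
rewrite /pushforward/= (_ : _ @^-1` _ = `]a - c, b - c]%classic).
  rewrite !lebesgue_measure_itv/= !lte_fin ltrD2r.
  by case: ifPn => // _; rewrite -!EFinB; congr (_%:E); ring.
by apply/seteqP; split => x /=; rewrite !in_itv/= => /andP[? ?]; apply/andP; split; lra.
Qed.

Lemma ge0_integral_shift (f : R -> R) (a b c : R) :
  measurable_fun setT f -> (forall x, 0 <= f x) ->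
  (\int[leb]_(x in `]a, b]) (f (x + c))%:E = \int[leb]_(x in `](a + c)%R, (b + c)%R]) (f x)%:E)%E.
Proof.
move=> mf f0.
have msh : measurable_fun setT (fun x : measurableTypeR R => x + c : measurableTypeR R).
  exact: measurable_funD.
have := @ge0_integral_pushforward _ _ (measurableTypeR R) (measurableTypeR R) R _ msh leb
  `]a + c, b + c]%classic (EFin \o f) (measurable_itv _).
rewrite (_ : _ @^-1` _ = `]a, b]%classic); last first.
  by apply/seteqP; split => x /=; rewrite !in_itv/= => /andP[? ?]; apply/andP; split; lra.
move=> <-.
- by apply: eq_measure_integral => A mA _; exact: lebesgue_measure_shift.
- by apply/measurable_EFinP; exact: measurable_funTS.
- by move=> y _; rewrite lee_fin.
Qed.

Lemma limn_einf_le (u : (\bar R)^nat) (C : \bar R) :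
  (forall n, (u n <= C)%E) -> (limn_einf u <= C)%E.
Proof.
move=> uC; rewrite limn_einf_lim; apply: lime_le; first exact: is_cvg_einfs.
near=> n; apply: le_trans (uC n); apply: ereal_inf_lbound; exists n => //=.
Unshelve. all: by end_near. Qed.

Section lower_derivative.
Variable psi : R -> R.
Hypothesis psi_ni : nonincreasing_fun psi.
Hypothesis psi0 : forall x, 0 <= psi x.

Let slope n x := n.+1%:R * (psi x - psi (x + n.+1%:R^-1)).

Let mpsi : measurable_fun setT psi.
Proof. exact: nonincreasing_measurable. Qed.

Let slope_ge0 n x : 0 <= slope n x.
Proof. by rewrite mulr_ge0// subr_ge0 psi_ni// lerDl. Qed.

Let mslope n : measurable_fun setT (slope n).
Proof.
apply: measurable_funM => //; apply: measurable_funB => //.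
by apply: measurableT_comp => //; exact: measurable_funD.
Qed.

Let ipsi (a b : R) : leb.-integrable `]a, b] (EFin \o psi).
Proof.
apply: measurable_bounded_integrable => //.
- by rewrite /= lebesgue_measure_itv/=; case: ifPn => // _; rewrite -EFinB ltry.
- exact: measurable_funTS.
exists (psi a); split; first exact: ger0_real.
move=> M aM x /=; rewrite in_itv/= => /andP[ax _].
by rewrite ger0_norm// (le_trans _ (ltW aM))// psi_ni// ltW.
Qed.

(** After a translation only [(n + 1)] times the difference of the integrals of [psi] over []a, a +
    d]] and []b, b + d]] remains, and monotonicity bounds it. Since [d <= 1], the value at [b + 1]
    serves for all [n]. *)
Let integral_slope n (a b : R) : a <= b ->
  (\int[leb]_(x in `]a, b]) (slope n x)%:E <= (psi a - psi (b + 1))%:E)%E.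
Proof.
move=> ab; set d := n.+1%:R^-1 : R.
have d0 : 0 < d by rewrite invr_gt0.
have d1 : d <= 1 by rewrite invf_le1// ler1n.
have shiftE : \int[leb]_(x in `]a, b]) psi (x + d) = \int[leb]_(x in `]a + d, b + d]) psi x.
  by rewrite /Rintegral ge0_integral_shift.
have ish : leb.-integrable `]a, b] (EFin \o (fun x => psi (x + d))).
  apply/integrableP; split.
    apply/measurable_EFinP; apply: measurable_funTS.
    by apply: measurableT_comp => //; exact: measurable_funD.
  under eq_integral do rewrite /= ger0_norm//.
  rewrite ge0_integral_shift//.
  by have /integrableP[_] := ipsi (a + d) (b + d); under eq_integral do rewrite /= ger0_norm//.
have mab : @measurable _ (measurableTypeR R) `]a, b]%classic by exact: measurable_itv.
have idiff : leb.-integrable `]a, b] (EFin \o (fun x => psi x - psi (x + d))).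
  by have := integrableB mab (ipsi a b) ish; apply: eq_integrable.
have islope : leb.-integrable `]a, b] (EFin \o slope n).
  by have := integrableZl mab n.+1%:R idiff; apply: eq_integrable.
rewrite -[leLHS]fineK; last exact: integrable_fin_num.
rewrite lee_fin -/(Rintegral _ _ _) RintegralZl//.
rewrite RintegralB// shiftE.
(* Both intervals are cut out of []a, b + d]], which also covers the case [b < a + d]. *)
have e1 : \int[leb]_(x in `]a, b + d]) psi x - \int[leb]_(x in `]a, b]) psi x =
    \int[leb]_(x in `]b, b + d]) psi x.
  by apply: Rintegral_itvB; rewrite ?bnd_simp// lerDl ltW.
have e2 : \int[leb]_(x in `]a, b + d]) psi x - \int[leb]_(x in `]a, a + d]) psi x =
    \int[leb]_(x in `]a + d, b + d]) psi x.
  by apply: Rintegral_itvB; rewrite ?bnd_simp// ?lerDl ?lerD2r// ltW.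
have len s : fine (leb `]s, s + d]) = d.
  by rewrite lebesgue_measure_itv/= lte_fin ltrDl d0/=; ring.
have icst (k s : R) : leb.-integrable `]s, s + d] (EFin \o cst k).
  apply: measurable_bounded_integrable => //.
    by rewrite /= lebesgue_measure_itv/=; case: ifPn => // _; rewrite -EFinB ltry.
  by exists `|k|; split => // M kM x _ /=; exact: ltW.
have u1 : \int[leb]_(x in `]a, a + d]) psi x <= psi a * d.
  rewrite -[in leRHS](len a) -Rintegral_cst//; apply: le_Rintegral => //; first exact: icst.
  by move=> x /=; rewrite in_itv/= => /andP[ax _]; rewrite psi_ni// ltW.
have u2 : psi (b + 1) * d <= \int[leb]_(x in `]b, b + d]) psi x.
  rewrite -[in leLHS](len b) -Rintegral_cst//; apply: le_Rintegral => //; first exact: icst.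
  move=> x /=; rewrite in_itv/= => /andP[_ xb]; apply: psi_ni.
  by rewrite (le_trans xb)// lerD2l.
have -> : psi a - psi (b + 1) = n.+1%:R * (psi a * d - psi (b + 1) * d).
  by rewrite -mulrBl mulrC -mulrA mulVf ?mulr1.
rewrite ler_wpM2l//; change (\int[leb]_(x in `]a, b]) psi x -
  \int[leb]_(x in `]a + d, b + d]) psi x <= psi a * d - psi (b + 1) * d).
have subC (x y z : R) : x - (y - z) = z - (y - x) by ring.
by rewrite -e2 subC e1 lerB.
Qed.

(** [Psi] is the lower limit of the difference quotients with steps [1 / (n + 1)], and Fatou's lemma
    carries their uniform integral bound over to it. *)
Lemma nonincreasing_lower_derivative : exists Psi : R -> \bar R,
  [/\ measurable_fun setT Psi, forall x, (0 <= Psi x)%E,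
      forall x l, h^-1 * (psi (h + x) - psi x) @[h --> 0^'+] --> l -> Psi x = (- l)%:E &
      forall a b, a <= b -> (\int[leb]_(x in `]a, b]) Psi x <= (psi a - psi (b + 1))%:E)%E].
Proof.
exists (fun x => limn_einf (fun n => (slope n x)%:E)); split.
- rewrite /limn_einf; apply: measurableT_comp => //.
  apply: (measurable_fun_limn_esup (f := fun n x => (- (slope n x)%:E)%E)) => n.
  by apply: measurableT_comp => //; exact/measurable_EFinP.
- move=> x; rewrite limn_einf_lim; apply: lime_ge; first exact: is_cvg_einfs.
  near=> n; apply: le_ereal_inf_tmp => _ [k _ <-].
  by rewrite lee_fin.
- move=> x l xl; apply: (cvg_limn_einf_sup _).1; apply: cvg_EFin; first by near=> n.
  have hc : (n.+1%:R^-1 : R) @[n --> \oo] --> (0 : R)^'+.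
    move=> P [e /= e0 He]; have [N _ HN] := near_infty_natSinv_lt (PosNum e0).
    exists N => // n /= Nn; apply: He => /=; last by rewrite invr_gt0.
    by rewrite sub0r normrN ger0_norm ?invr_ge0//; exact: HN.
  rewrite (_ : _ \o _ = fun n => - (n.+1%:R^-1^-1 * (psi (n.+1%:R^-1 + x) - psi x))).
    by apply: cvgN; exact: (cvg_comp _ _ hc xl).
  by apply/funext => n /=; rewrite invrK /slope (addrC x); ring.
- move=> a b ab; apply: (@le_trans _ _ (limn_einf (fun n => \int[leb]_(x in `]a, b]) (slope n x)%:E)%E)).
    apply: fatou => //.
    + by move=> n; apply/measurable_EFinP; apply: measurable_funTS; exact: mslope.
    + by move=> n x _; rewrite lee_fin.
  by apply: limn_einf_le => n; exact: integral_slope.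
Unshelve. all: by end_near. Qed.
End lower_derivative.
End monotone.

(** * Curves of maximal slope *)

Section curves.
Context {R : realType} {dX : measure_display} {X : measurableType dX}.
Local Notation leb := (@lebesgue_measure R).
Variable dist : X -> X -> R.
Hypothesis pb : polish_borel dist.
Variable p : R.
Hypothesis p1 : 1 < p.

Let p0 : 0 < p. Proof. exact: lt_trans p1. Qed.

Lemma ae_exists_itv (P : R -> Prop) a b : a < b -> {ae leb, forall t, P t} ->
  exists2 t, a < t < b & P t.
Proof.
move=> ab [N [mN N0 PN]]; apply: contrapT => nex.
have : (leb `]a, b[ <= leb N)%E.
  apply: le_measure; rewrite ?inE//.
  move=> t /=; rewrite in_itv/= => atb; apply: PN => Pt; apply: nex.
  by exists t.
rewrite N0 lebesgue_measure_itv/= lte_fin ab -EFinB lee_fin; lra.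
Qed.

(** [mder] is a [lim], which has a meaning only where the limit exists; estimates use the integrable
    function [D] in its place. The endpoints are left out because the two-sided limit there also
    sees the curve outside [[0, T]]. *)
Lemma AC_metric_derivative T (rho : R -> probability X R) : 0 < T ->
  AC_on dist p T rho -> exists D : R -> R,
  [/\ leb.-integrable setT (EFin \o D), forall x, 0 <= D x,
      forall s t, 0 <= s -> s <= t -> t <= T ->
        Wp dist p (rho s) (rho t) <= \int[leb]_(x in `]s, t]) D x &
      {ae leb, forall t, 0 < t < T -> mder dist p rho t = D t}].
Proof.
move=> T0 [PT [m [im mW]]].
(* Clamping extends the curve to the whole line. *)
pose cl t := Num.min T (Num.max 0 t).
have cl_itv t : 0 <= cl t <= T.
  by rewrite /cl le_min ge_min lexx/= andbT (ltW T0)/= le_max lexx.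
have cl_id t : 0 <= t <= T -> cl t = t.
  by move=> /andP[t0 tT]; rewrite /cl max_r// min_r.
have Pcl t : Pp dist p (rho (cl t)) by apply: PT; exact: cl_itv.
pose om s t := Wp dist p (rho (cl s)) (rho (cl t)).
pose w := (fun x => `|m x|) \_ `[0, T].
have w0 x : 0 <= w x by rewrite /w patchE; case: ifPn.
have iw : leb.-integrable setT (EFin \o w).
  have mT : @measurable _ (measurableTypeR R) `[0, T]%classic by exact: measurable_itv.
  rewrite (_ : EFin \o w = (EFin \o (fun x => `|m x|)) \_ `[0, T]).
    by apply/(integrable_mkcond _ mT); exact: integrable_norm.
  by rewrite /w restrict_EFin.
have omw s t : s <= t -> om s t <= \int[leb]_(x in `]s, t]) w x.
  (* Either both times clamp to the same point, or clamping only shrinks the interval from [s] to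
     [t]. *)
  move=> st; have [clst|clst] := leP (cl t) (cl s).
    have -> : om s t = 0.
      rewrite /om; suff -> : cl t = cl s by exact: Wp_refl.
      apply/eqP; rewrite eq_le clst/= /cl le_min !ge_min lexx/=.
      by rewrite ge_max !le_max !lexx st !orbT.
    by apply: Rintegral_ge0 => x _.
  have scl : s <= cl s.
    have [h|h] := leP (Num.max 0 s) T; first by rewrite /cl (min_r h) le_max lexx orbT.
    have /andP[_ ctT] := cl_itv t; move: (lt_le_trans clst ctT).
    by rewrite /cl (min_l (ltW h)) ltxx.
  have clt : cl t <= t.
    have [t0|t0] := leP 0 t; first by rewrite /cl (max_r t0) ge_min lexx orbT.
    have /andP[cs0 _] := cl_itv s; move: (le_lt_trans cs0 clst).
    by rewrite /cl (max_l (ltW t0)) lt_min ltxx andbF.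
  have [cs0 csT] := andP (cl_itv s); have [ct0 ctT] := andP (cl_itv t).
  have := mW _ _ cs0 clst ctT; rewrite Wp_sym// => W1.
  have i1 : leb.-integrable `[cl s, cl t] (EFin \o w) by exact: integrable_itv.
  rewrite -lee_fin /om; apply: (le_trans W1).
  have sub : `[cl s, cl t] `<=` `[0, T]%classic.
    by move=> x /=; rewrite !in_itv/= => /andP[? ?]; apply/andP; split; lra.
  apply: (@le_trans _ _ (\int[leb]_(x in `[cl s, cl t]) (w x)%:E)%E).
    apply: le_integral => //.
      exact: integrableS im.
    move=> x; rewrite inE => /= xs; rewrite lee_fin /w patchE mem_set ?ler_norm//.
    exact: sub.
  rewrite -integral_itv_obnd_cbnd; last first.
    exact: (measurable_int leb (integrable_itv `]cl s, cl t] iw)).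
  rewrite /Rintegral fineK; last first.
    by apply: integrable_fin_num => //; exact: integrable_itv.
  apply: ge0_subset_integral => //.
  - exact: (measurable_int leb (integrable_itv `]s, t] iw)).
  - by move=> x _; rewrite lee_fin.
  - by move=> x /=; rewrite !in_itv/= => /andP[? ?]; apply/andP; split; lra.
have om_sym s t : om s t = om t s by exact: Wp_sym.
have om_tri s t u : om s u <= om s t + om t u by exact: Wp_triangle.
have [D [iD D0 omD aeD]] := @metric_derivative R om w om_sym om_tri iw w0 omw.
exists D; split => //.
  move=> s t s0 st tT; have := omD s t st.
  by rewrite /om !cl_id//; apply/andP; split => //; lra.
apply: (aeS aeD) => t tD /andP[t0 tT].
suff tW : Wp dist p (rho t) (rho s) / `|t - s| @[s --> t^'] --> D t.
  exact: (cvg_lim (@Rhausdorff R) tW).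
apply: cvg_trans tD; apply: near_eq_cvg.
have : \forall s \near t, 0 < s < T.
  by near=> s; apply/andP; split; near: s; [exact: lt_nbhsr|exact: lt_nbhsl].
move=> /nbhs_dnbhs; apply: filterS => s /andP[s0 sT].
by rewrite /om !cl_id// ?ltW//; apply/andP; split; exact: ltW.
Unshelve. all: by end_near. Qed.

(** Either [D <= delta], or D = D^p / D^(p-1) <= D^p / delta^(p-1). This bound, affine in the
    dissipation, plays the role of Hölder's inequality in [recurrence]. *)
Lemma powR_le_split (D v delta : R) : 0 < delta -> 0 <= D -> p^-1 * D `^ p <= v ->
  D <= delta + p / delta `^ (p - 1) * v.
Proof.
move=> d0 D0 Dv.
have v0 : 0 <= v by apply: le_trans Dv; rewrite mulr_ge0 ?powR_ge0// invr_ge0 ltW.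
have dp0 : 0 < delta `^ (p - 1) by exact: powR_gt0.
have K0 : 0 <= p / delta `^ (p - 1) by rewrite divr_ge0// ltW.
have [Dd|dD] := leP D delta; first by rewrite (le_trans Dd)// lerDl mulr_ge0.
have DE : D `^ p = D * D `^ (p - 1).
  by rewrite mulrC -[X in _ * X]powRr1// -powRD; [congr (_ `^ _); ring|rewrite (gt_eqF (lt_trans d0 dD)) implybT].
have h : D * delta `^ (p - 1) <= p * v.
  apply: (@le_trans _ _ (D `^ p)); last by rewrite -ler_pdivrMl.
  rewrite DE ler_wpM2l//; apply: ge0_ler_powR; rewrite ?nnegrE ?(ltW d0) ?(ltW dD)//.
  by rewrite subr_ge0 ltW.
have : D <= p / delta `^ (p - 1) * v by rewrite mulrAC ler_pdivlMr.
lra.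
Qed.

(** * Dissipation along a fixed curve of maximal slope *)

Variables (E G : probability X R -> \bar R) (rho : R -> probability X R).
Hypothesis G0 : forall mu, Pp dist p mu -> (0 <= G mu)%E.
Hypothesis E1 : A1 dist p E.
Hypothesis G3 : A3 dist p G.
Hypothesis rhoAC : AC_infty dist p rho.
Variable phi : R -> R.
Hypothesis Ephi : {ae leb, forall t, 0 <= t -> E (rho t) = (phi t)%:E}.
Hypothesis phi_ni : forall s t, 0 <= s -> s <= t -> phi t <= phi s.
Hypothesis slope : {ae leb, forall t, 0 <= t ->
   derivable phi t 1 /\
   ((derive1 phi t)%:E = - (p^-1 * (mder dist p rho t) `^ p)%:E
      - (conj_exp p)^-1%:E * (G (rho t) `^ (conj_exp p)))%E}.

Let q := conj_exp p.
Let q0 : 0 < q. Proof. by rewrite /q /conj_exp divr_gt0// subr_gt0. Qed.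

Lemma rho_Pp t : 0 <= t -> Pp dist p (rho t).
Proof.
move=> t0; have [|P _] := rhoAC (T := t + 1); first by lra.
by apply: P; apply/andP; split => //; lra.
Qed.

(** Monotonicity carries the lower bound of [E] back to [t] from a slightly later time at which
    [phi] equals the energy. *)
Lemma phi_ge : exists c, forall t, 0 <= t -> c <= phi t.
Proof.
have [_ [c cE] _] := E1; exists c => t t0.
have [|s /andP[ts _] Es] := @ae_exists_itv _ t (t + 1) _ Ephi; first by lra.
have s0 : 0 <= s by lra.
apply: le_trans (phi_ni t0 (ltW ts)).
by rewrite -lee_fin -Es//; apply: cE; exact: rho_Pp.
Qed.

Lemma rho_right_continuous t e : 0 <= t -> 0 < e -> exists2 d, 0 < d &
  forall s, t <= s -> s < t + d -> dLP dist (rho s) (rho t) <= e.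
Proof.
move=> t0 e0; have [d d0 Wd] := Wp_dLP pb p1 e0.
have t10 : 0 < t + 1 by lra.
have [D [iD D0 WD _]] := AC_metric_derivative t10 (rhoAC t10).
have [r r0 Hr] := prim_small iD d0.
exists (Num.min r 1); first by rewrite lt_min r0 ltr01.
move=> s ts; rewrite -ltrBlDl lt_min => /andP[sr s1].
rewrite dLP_sym; apply: Wd; try by apply: rho_Pp; lra.
apply: le_lt_trans (Hr t s ts sr).
apply: le_trans (WD t s t0 ts _) _; first by lra.
apply: le_Rintegral_itv => // [|x]; last exact: ler_norm.
exact: (integrable_norm iD).
Qed.

Lemma lsc_le (F : probability X R -> \bar R) mu c : sigma_lsc dist p F -> Pp dist p mu ->
  (forall d, 0 < d -> exists nu, [/\ Pp dist p nu, dLP dist nu mu < d & (F nu <= c%:E)%E]) ->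
  (F mu <= c%:E)%E.
Proof.
move=> Flsc Pmu H; rewrite leNgt; apply/negP => /(Flsc _ Pmu)[d d0 Hd].
have [nu [Pnu nud]] := H d d0.
by rewrite leNgt Hd.
Qed.

(** Times shortly after [t] satisfy [E (rho s) = phi s], and lower semicontinuity passes the bound
    to [t]. Every time counts here, since the whole curve must lie in one sublevel. *)
Lemma E_rho_le t : 0 <= t -> (E (rho t) <= (phi 0)%:E)%E.
Proof.
move=> t0; have [_ _ Elsc] := E1.
apply: (lsc_le Elsc (rho_Pp t0)) => e e0.
have [d d0 Hd] := rho_right_continuous t0 (divr_gt0 e0 (ltr0n R 2)).
have [|s /andP[ts sd] Es] := @ae_exists_itv _ t (t + d) _ Ephi; first by lra.
have s0 : 0 <= s by lra.
exists (rho s); split; first exact: rho_Pp.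
  by apply: le_lt_trans (Hd s (ltW ts) sd) _; lra.
by rewrite Es// lee_fin phi_ni.
Qed.

(* [Psi] is a lower derivative of -phi, defined and measurable everywhere. *)
Lemma dissipation : exists Psi : R -> \bar R,
  [/\ measurable_fun setT Psi, forall x, (0 <= Psi x)%E,
      {ae leb, forall t, 0 < t -> ((p^-1 * (mder dist p rho t) `^ p)%:E <= Psi t)%E /\
          (G (rho t) `^ q <= q%:E * Psi t)%E} &
      forall a b, 0 <= a -> a <= b ->
        (\int[leb]_(x in `]a, b]) Psi x <= (phi a - phi (b + 1))%:E)%E].
Proof.
have [c cphi] := phi_ge.
(* Constant on the negative half-line and shifted by the lower bound, so as to be nonincreasing and
   nonnegative on the whole line. *)
pose psi x := phi (Num.max 0 x) - c.
have [|x|Psi [mPsi Psi0 PsiE PsiI]] := @nonincreasing_lower_derivative R psi.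
- move=> x y yx; rewrite /psi lerD2r; apply: phi_ni; first by rewrite le_max lexx.
  by rewrite ge_max !le_max lexx yx orbT.
- by rewrite /psi subr_ge0 cphi// le_max lexx.
exists Psi; split => //; last first.
  move=> a b a0 ab; apply: le_trans (PsiI a b ab) _.
  by rewrite /psi !max_r//; [rewrite lee_fin; lra|lra].
apply: (aeS slope) => t H t0; have [dphi] := H (ltW t0).
have -> : Psi t = (- derive1 phi t)%:E.
  apply: PsiE.
  have {}dphi : (h^-1 *: (phi (h *: 1 + t) - phi t)) @[h --> 0^'] --> derive1 phi t.
    by rewrite derive1E; exact: dphi.
  have right0 : (0 : R)^'+ `=>` 0^'.
    by move=> P [e e0 He]; exists e => // x xe x0; apply: He => //; rewrite gt_eqF.
  apply: cvg_trans (cvg_trans (cvg_app _ right0) dphi).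
  apply: near_eq_cvg; near=> h.
  have h0 : 0 < h by near: h; exact: nbhs_right_gt.
  rewrite /psi /= [h%:A]mulr1 !max_r//; [|lra|lra].
  by rewrite opprB addrA subrK.
have a0 : 0 <= p^-1 * mder dist p rho t `^ p.
  by rewrite mulr_ge0 ?powR_ge0// invr_ge0 ltW.
have g0 : (0 <= G (rho t) `^ q)%E by exact: poweR_ge0.
rewrite -/q; move: a0 g0; set a := p^-1 * _; case: (G (rho t) `^ q)%E => [r||]//=.
- move=> a0; rewrite lee_fin => r0; rewrite -EFinD => -[->].
  have qr : 0 <= q^-1 * r by rewrite mulr_ge0// invr_ge0 ltW.
  split; first by rewrite lee_fin; lra.
  rewrite -EFinM lee_fin -ler_pdivrMl//; lra.
(* An infinite slope would equate the real number [derive1 phi t] with -oo. *)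
- by move=> a0 _; rewrite gt0_muley ?lte_fin ?invr_gt0//.
Unshelve. all: by end_near. Qed.

Lemma phi_cauchy e : 0 < e -> exists2 T, 0 <= T & forall s t, T <= s -> s <= t ->
  phi s - phi t < e.
Proof.
move=> e0; have [c cphi] := phi_ge.
pose S := [set phi t | t in [set t | 0 <= t]].
have hS : has_inf S.
  split; first by exists (phi 0), 0 => //=.
  by exists c => _ [t t0 <-]; exact: cphi.
have [_ [T T0 <-] Te] := inf_adherent e0 hS.
exists T => // s t Ts st.
have h1 := phi_ni T0 Ts.
have : inf S <= phi t by apply: ge_inf; [exact: hS.2|exists t => //=; move: T0 => /=; lra].
lra.
Qed.

Lemma recurrence e : 0 < e -> exists2 T, 0 <= T & forall t, T <= t ->
  exists s, [/\ 0 <= s, dLP dist (rho t) (rho s) < e & (G (rho s) `^ q < e%:E)%E].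
Proof.
move=> e0; have [d d0 Wd] := Wp_dLP pb p1 (divr_gt0 e0 (ltr0n R 2)).
have [Psi [mPsi Psi0 aePsi PsiI]] := dissipation.
pose delta := d / 2.
have delta0 : 0 < delta by rewrite divr_gt0.
pose K := p / delta `^ (p - 1).
have K0 : 0 < K by rewrite divr_gt0// powR_gt0.
(* The first bound keeps the displacement below [delta + K * eta <= 3 * d / 4], the second one gives
   [q * Psi s < e]. *)
pose eta := Num.min (delta / (2 * K)) (e / q).
have eta0 : 0 < eta by rewrite lt_min; apply/andP; split; apply: divr_gt0 => //; exact: mulr_gt0.
have [T T0 HT] := phi_cauchy eta0.
exists T => // t Tt.
have t0 : 0 <= t by exact: le_trans Tt.
(* The integral bound overshoots the window by 1, so the drop of [phi] is taken from [t] to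
   [t + 2]. *)
have Ilt : (\int[leb]_(x in `]t, (t + 1)%R]) Psi x < eta%:E)%E.
  apply: le_lt_trans (PsiI t (t + 1) t0 _) _; first by lra.
  by rewrite lte_fin; apply: HT => //; lra.
have len : leb `]t, t + 1] = 1%E.
  by rewrite lebesgue_measure_itv/= lte_fin ltrDl ltr01 -EFinB; congr (_%:E); ring.
have mPsiS A : measurable_fun A Psi by exact: measurable_funTS.
(* The window has length 1: if [Psi >= eta] held almost everywhere on it, the integral would be at
   least [eta]. *)
have [s [/andP[ts st1] Gs Ps]] : exists s, [/\ t < s <= t + 1,
    (G (rho s) `^ q <= q%:E * Psi s)%E & (Psi s < eta%:E)%E].
  apply: contrapT => nex; move: Ilt; apply/negP; rewrite -leNgt.
  rewrite -[leLHS]mule1 -len -integral_cst//.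
  apply: ae_ge0_le_integral => //.
  - by move=> x _; rewrite lee_fin ltW.
  - exact: mPsiS.
  apply: (aeS aePsi) => x Px /=; rewrite in_itv/= => /andP[tx xt].
  rewrite leNgt; apply/negP => Psix; apply: nex; exists x.
  by split => //; [exact/andP|apply: (Px _).2; lra].
have s0 : 0 <= s by lra.
exists s; split => //; last first.
  apply: (le_lt_trans Gs); apply: (@lt_le_trans _ _ (q%:E * eta%:E)%E).
    by rewrite lte_pmul2l// lte_fin.
  rewrite -EFinM lee_fin; apply: (@le_trans _ _ (q * (e / q))).
    by rewrite ler_pM2l// ge_min lexx orbT.
  by rewrite mulrCA mulfV ?mulr1// gt_eqF.
suff WL : Wp dist p (rho t) (rho s) < d.
  by apply: le_lt_trans (Wd _ _ (rho_Pp t0) (rho_Pp s0) WL) _; lra.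
(* The window then lies inside []0, t + 2[], where [mder] agrees almost everywhere with [D]. *)
have t20 : 0 < t + 2 by lra.
have [D [iD D0 WD aeD]] := AC_metric_derivative t20 (rhoAC t20).
apply: le_lt_trans (WD t s t0 (ltW ts) _) _; first by lra.
apply: (@le_lt_trans _ _ (delta + K * eta)); last first.
  apply: (@le_lt_trans _ _ (delta + delta / 2)); last by rewrite /delta; lra.
  rewrite lerD2l; apply: (@le_trans _ _ (K * (delta / (2 * K)))).
    by rewrite ler_pM2l// ge_min lexx.
  by rewrite le_eqVlt; apply/orP; left; apply/eqP; field; rewrite gt_eqF.
have iDs : leb.-integrable `]t, s] (EFin \o D) by exact: integrable_itv.
rewrite -lee_fin /Rintegral fineK; last by apply: integrable_fin_num => //; exact: measurable_itv.
have sub : `]t, s] `<=` `]t, t + 1]%classic.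
  by move=> x /=; rewrite !in_itv/= => /andP[? ?]; apply/andP; split; lra.
apply: (@le_trans _ _ (\int[leb]_(x in `]t, (t + 1)%R]) (D x)%:E)%E).
  apply: ge0_subset_integral => //.
  - exact: (measurable_int leb (integrable_itv `]t, t + 1] iD)).
  - by move=> x _; rewrite lee_fin.
apply: (@le_trans _ _ (\int[leb]_(x in `]t, (t + 1)%R]) (delta%:E + K%:E * Psi x)%E)%E).
  apply: ae_ge0_le_integral => //.
  - by move=> x _; rewrite lee_fin.
  - exact: (measurable_int leb (integrable_itv `]t, t + 1] iD)).
  - move=> x _; apply: adde_ge0; first by rewrite lee_fin ltW.
    by apply: mule_ge0 => //; rewrite lee_fin ltW.
  - apply: emeasurable_funD; first exact: measurable_cst.
    by apply: emeasurable_funM; [exact: measurable_cst|exact: mPsiS].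
  apply: (aeS2 aePsi aeD) => x Px Dx /=; rewrite in_itv/= => /andP[tx xt].
  have [] := Px _; first by lra.
  rewrite Dx; last by apply/andP; split; lra.
  case: (Psi x) (Psi0 x) => [v||]//= v0; last first.
    by move=> _ _; rewrite gt0_muley ?lte_fin// addey// leey.
  by rewrite !lee_fin => pv _; exact: powR_le_split.
rewrite ge0_integralD//; last 3 first.
- by move=> x _; rewrite lee_fin ltW.
- by move=> x _; rewrite mule_ge0// lee_fin ltW.
- by apply: emeasurable_funM; [exact: measurable_cst|exact: mPsiS].
rewrite integral_cst//.
rewrite [X in (delta%:E * X)%E](_ : _ = 1%E)//.
rewrite mule1 ge0_integralZl//; [|exact: mPsiS|by rewrite lee_fin ltW].
apply: (@le_trans _ _ (delta%:E + K%:E * eta%:E)%E); last by rewrite -EFinM -EFinD.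
by apply: leeD2l; apply: lee_wpmul2l; [rewrite lee_fin ltW|exact: (ltW Ilt)].
Qed.

(** Along the constant curve the metric derivative and the derivative of the energy vanish, so the
    slope equation reduces to the vanishing of [G mu]. *)
Lemma stationary_slope0 mu : Pp dist p mu -> (E mu < +oo)%E -> G mu = 0%E ->
  stationary dist p E G mu.
Proof.
move=> Pmu Emu Gmu; split => //; split.
  move=> T T0; split=> [//|]; exists (cst 0); split.
    exact: integrable0.
  by move=> s t _ _ _; rewrite Wp_refl// integral0.
have [[_ Eny] _ _] := E1.
have Efin : E mu \is a fin_num by rewrite fin_real// Eny.
exists (cst (fine (E mu))); split.
- by apply: aeW => t _; rewrite /= fineK.
- by [].
- apply: aeW => t t0; split; first exact: derivable_cst.
  rewrite derive1_cst Gmu poweR0r ?gt_eqF// mule0 sube0.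
  have -> : mder dist p (fun _ => mu) t = 0.
    rewrite /mder; apply: cvg_lim => //.
    under eq_fun do rewrite Wp_refl// mul0r.
    exact: cvg_cst.
  by rewrite powR0 ?gt_eqF// mulr0 oppe0.
Qed.

(* G vanishes at mu: near each late rho(u n) there is, by [recurrence], a state of
   small slope. *)
Lemma limit_point_stationary (u : nat -> R) mu : (forall n, n%:R <= u n) ->
  Pp dist p mu -> dLP_cvg dist (rho \o u) mu -> stationary dist p E G mu.
Proof.
move=> un Pmu umu.
have un0 n : 0 <= u n by apply: le_trans (un n).
have near_mu e N : 0 < e -> exists2 n, N <= u n & dLP dist (rho (u n)) mu < e.
  move=> e0; have /cvgrPdist_lt/(_ _ e0)[M _ HM] := umu.
  exists (maxn M (Num.truncn N).+1).
    apply: le_trans (un _); apply/ltW/(lt_le_trans (truncnS_gt N)).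
    by rewrite ler_nat leq_maxr.
  have := HM (maxn M (Num.truncn N).+1) (leq_maxl _ _).
  by rewrite /= sub0r normrN ger0_norm// dLP_ge0.
have [_ _ Elsc] := E1.
apply: stationary_slope0 => //.
  apply: (@le_lt_trans _ _ (phi 0)%:E); last exact: ltry.
  apply: (lsc_le Elsc Pmu) => d d0.
  have [n _ nd] := near_mu d 0 d0.
  by exists (rho (u n)); split => //; [exact: rho_Pp|exact: E_rho_le].
apply/eqP; rewrite eq_le G0// andbT; apply/lee_addgt0Pr => c c0; rewrite add0e.
apply: (lsc_le G3 Pmu) => d d0.
(* The other half of [d] is spent between [rho (u n)] and [mu]; the bound c^q on G^q yields
   [G <= c]. *)
pose e := Num.min (d / 2) (c `^ q).
have e0 : 0 < e by rewrite lt_min divr_gt0// powR_gt0.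
have [T T0 HT] := recurrence e0.
have [n Tn nd] := near_mu (d / 2) T (divr_gt0 d0 (ltr0n R 2)).
have [s [s0 ds Gs]] := HT _ Tn.
exists (rho s); split; first exact: rho_Pp.
  rewrite [ltRHS]splitr; apply: (dLP_triangle_lt pb _ nd).
  by rewrite dLP_sym; apply: lt_le_trans ds _; rewrite ge_min lexx.
rewrite leNgt; apply/negP => cG.
have : (c%:E `^ q <= G (rho s) `^ q)%E.
  apply: (gt0_ler_poweR (ltW q0)); rewrite ?in_itv/= ?leey ?andbT.
  - by rewrite lee_fin ltW.
  - by apply: G0; exact: rho_Pp.
  - exact: ltW.
apply/negP; rewrite -ltNge poweR_EFin; apply: lt_le_trans Gs _.
by rewrite lee_fin ge_min lexx orbT.
Qed.

(** Otherwise some times [u n >= n] would keep the distance at least [e], against the limit point in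
    [S]. This point also excludes an empty [S], for which the infimum is +oo. *)
Lemma dsigma_cvg0 (S : set (probability X R)) :
  (forall u : nat -> R, (forall n, n%:R <= u n) -> exists f : nat -> nat,
     exists2 mu, S mu & dLP_cvg dist (rho \o u \o f) mu) ->
  dsigma_set dist (rho t) S @[t --> +oo] --> 0%E.
Proof.
move=> H.
have ds0 t : (0 <= dsigma_set dist (rho t) S)%E.
  by apply: le_ereal_inf_tmp => _ [nu _ <-]; rewrite lee_fin dLP_ge0.
have key (e : R) : 0 < e -> exists M : R, forall t, M < t ->
    (dsigma_set dist (rho t) S < e%:E)%E.
  move=> e0; apply: contrapT => nM.
  have /choice[u uP] : forall n : nat, exists t, n%:R <= t /\
      (e%:E <= dsigma_set dist (rho t) S)%E.
    move=> n; apply: contrapT => nt; apply: nM; exists n%:R => t nt'.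
    rewrite ltNge; apply/negP => et; apply: nt; exists t; split => //.
    exact: ltW.
  have [f [mu Smu /cvgrPdist_lt/(_ _ e0)[M _ HM]]] := H u (fun n => (uP n).1).
  have := HM M (leqnn M); rewrite /= sub0r normrN ger0_norm ?dLP_ge0//.
  apply/negP; rewrite -leNgt -lee_fin.
  apply: le_trans (uP (f M)).2 _.
  by apply: ereal_inf_lbound; exists mu.
move=> P /= [e /= e0 He].
have [M HM] := key e e0.
exists M; split; first exact: num_real.
move=> t Mt /=; have := HM t Mt.
case: (dsigma_set dist (rho t) S) (ds0 t) => [r||]//=.
rewrite lee_fin lte_fin => r0 re; apply: He => /=.
by rewrite sub0r normrN ger0_norm.
Qed.

(** [S] is left open to serve both conclusions. The last hypothesis hands over the approximating
    times, so that the closedness of [Y] can be applied to them. *)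
Lemma relcompact_dsigma_cvg0 (A S : set (probability X R)) :
  sigma_relcompact dist p A -> (forall t, 0 <= t -> A (rho t)) ->
  (forall u mu, (forall n, n%:R <= u n) -> Pp dist p mu ->
     dLP_cvg dist (rho \o u) mu -> stationary dist p E G mu -> S mu) ->
  dsigma_set dist (rho t) S @[t --> +oo] --> 0%E.
Proof.
move=> cA Arho HS; apply: dsigma_cvg0 => u un.
have [n|f [fi [mu Pmu fmu]]] := cA (rho \o u).
  by apply: Arho; apply: le_trans (un n).
exists f, mu => //.
have uf n : n%:R <= (u \o f) n.
  apply: le_trans (un _); rewrite ler_nat.
  elim: n => // n ih; apply: (leq_ltn_trans ih).
  exact: fi.
apply: (HS (u \o f) mu) => //.
exact: (@limit_point_stationary (u \o f)).
Qed.

End curves.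

Theorem theorem2p16 (R : realType) (dX : measure_display) (X : measurableType dX)
    (dist : X -> X -> R) (p : R) (E G : probability X R -> \bar R) :
  polish_borel dist -> 1 < p ->
  E_proper dist p E ->
  (forall mu, Pp dist p mu -> (0 <= G mu)%E) ->
  weak_upper_gradient dist p E G ->
  A1 dist p E -> A3 dist p G ->
  (forall rho0, ZE dist p E rho0 ->
     exists rho, max_slope_curve dist p E G rho /\ rho 0 = rho0) ->
  forall rho : R -> probability X R,
    max_slope_curve dist p E G rho -> ZE dist p E (rho 0) ->
    ((A2 dist p E \/ exists Y, A2' dist p E rho Y) ->
       dsigma_set dist (rho t) (stationary dist p E G) @[t --> +oo] --> 0%E) /\
    (forall Y, A2' dist p E rho Y -> sigma_closed dist p Y ->
       dsigma_set dist (rho t) (stationary dist p E G `&` Y) @[t --> +oo] --> 0%E).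
Proof.
move=> pb p1 _ G0 _ E1 G3 _ rho [rhoAC [phi [Ephi phi_ni slope]]] _.
have cvg0 := relcompact_dsigma_cvg0 pb p1 G0 E1 G3 rhoAC Ephi phi_ni slope.
have rhoP t : 0 <= t -> Pp dist p (rho t) by exact: rho_Pp.
have rhoE t : 0 <= t -> (E (rho t) <= (phi 0)%:E)%E.
  exact: (E_rho_le pb p1 E1 rhoAC Ephi phi_ni).
split=> [[cE|[Y [YP rhoY cY]]]|Y [YP rhoY cY] [_ Yclosed]].
- by apply: (cvg0 _ _ (cE (phi 0))) => // t t0; split; [exact: rhoP|exact: rhoE].
- by apply: (cvg0 _ _ (cY (phi 0))) => // t t0; split; [exact: rhoP|exact: rhoY|exact: rhoE].
- apply: (cvg0 _ _ (cY (phi 0))) => [t t0|u mu un Pmu umu mu_st].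
    by split; [exact: rhoP|exact: rhoY|exact: rhoE].
  split => //; apply: Yclosed umu => // n.
  by apply: rhoY; apply: le_trans (un n).
Qed.
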